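(* Let $(X,L)$ be a polarized complex abelian variety. Let $\ell_{X,L}$ be the length of the shortest geodesic segment joining the origin of $X$ to a nonzero point of $K(L)$, and let $N_{X,L}$ be the number of points of $K(L)$ at this minimal distance from the origin. Then the robustness $\mathscr{R}_\sigma(X,L)$ with respect to Gaussian displacement noise of variance $\sigma^2$ satisfies $$1-\mathscr{R}_\sigma(X,L)\sim\frac{2N_{X,L}\,\sigma}{\ell_{X,L}\sqrt{2\pi}}\exp\Big(-\frac{\ell_{X,L}^2}{8\sigma^2}\Big)\qquad\text{as }\sigma\to0.$$
   Context: A polarized complex abelian variety $(X,L)$ is a complex abelian variety $X$ together with an ample line bundle $L\to X$. Write $X=V/\Lambda$, where $\pi:V\to X$ is the universal cover ($V$ a complex vector space of dimension $n$, $\Lambda\subset V$ a lattice of rank $2n$), and let $H$ be the positive definite hermitian form on $V$ induced by the polarization, i.e. the form whose imaginary part $E=\operatorname{Im}H$ is integer-valued on $\Lambda$ and represents $c_1(L)$. Put $|v|^2=H(v,v)$; this gives a flat metric on $V$ and on $X$, with respect to which lengths and distances are taken. For $x\in X$ let $t_x:X\to X$ be translation by $x$. Let $K(L)=\{x\in X:t_x^*L\cong L\}$, which is the kernel of the polarization isogeny $\phi_L:X\to\widehat X=\mathrm{Pic}^0(X)$, $x\mapsto t_x^*L\otimes L^{-1}$; in lattice terms, $K(L)=\Lambda^\perp/\Lambda$ with $\Lambda^\perp=\{\mu\in V:E(\mu,\Lambda)\subset\mathbb{Z}\}$. A decoder is a measurable section $\mathcal{D}:\widehat X\to X$ of $\phi_L$.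 For a Borel probability measure $\rho$ on $X$, the robustness is $\mathscr{R}_\rho(X,L)=\sup_{\mathcal{D}}\rho(\operatorname{im}\mathcal{D})$, the supremum being over all decoders. For $\sigma>0$, let $\rho_\sigma$ be the pushforward to $X$ under $\pi$ of the centered Gaussian measure of variance $\sigma^2$ on $V$, i.e. the measure with density $(2\pi\sigma^2)^{-n}e^{-|v|^2/(2\sigma^2)}$ with respect to the volume form of the metric, and set $\mathscr{R}_\sigma(X,L)=\mathscr{R}_{\rho_\sigma}(X,L)$. For positive functions, $u(\sigma)\sim v(\sigma)$ as $\sigma\to0$ means $u(\sigma)/v(\sigma)\to1$.
   Formalization: N_{X,L} counts each nearest point of K(L) with the number of shortest geodesic segments joining it to the origin (the bare count fails, e.g. for C/Z[i] with H=2v·conj(w), where 4 rather than 2 is right); K(L) is assumed to have a nonzero point, so that ℓ is defined. *)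

(* Defs.v *)
From HB Require Import structures.
From mathcomp Require Import all_boot all_order all_algebra.
From mathcomp Require Import generic_quotient ring_quotient complex.
From mathcomp Require Import finmap all_classical all_reals all_analysis.

Set Implicit Arguments.
Unset Strict Implicit.
Unset Printing Implicit Defensive.

Import Order.TTheory GRing.Theory Num.Theory.
Import numFieldNormedType.Exports.

Local Open Scope classical_set_scope.
Local Open Scope ring_scope.

Section ComplexTorus.
Context {R : realType} {V : vectType R[i]}.

(* A lattice of rank 2n in the n-dimensional complex space V: the Z-span of an
   R-basis of V.  A family of 2n vectors that is free over R is an R-basis. *)
Definition is_lattice (Lam : zmodClosed V) : Prop :=
  exists b : 'I_(dim V + dim V) -> V,
    (forall c : 'I_(dim V + dim V) -> R,
       \sum_i (c i)%:C%C *: b i = 0 -> forall i, c i = 0) /\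
    (forall v : V, v \in Lam <->
       exists k : 'I_(dim V + dim V) -> int, v = \sum_i b i *~ k i).

Definition universal_cover (Lam : zmodClosed V) : Type := V.

HB.instance Definition _ Lam := GRing.Zmodule.copy (universal_cover Lam) V.
HB.instance Definition _ Lam := isPointed.Build (universal_cover Lam) 0.

Definition torus (Lam : zmodClosed V) : Type := Quotient.quot Lam.

HB.instance Definition _ Lam :=
  GRing.Zmodule.copy (torus Lam) (Quotient.quot Lam).
HB.instance Definition _ Lam := isPointed.Build (torus Lam) 0.

Definition cover (Lam : zmodClosed V) (v : V) : torus Lam :=
  (\pi_(Quotient.quot Lam) v)%qT.

Definition lift (Lam : zmodClosed V) (x : torus Lam) : V :=
  repr (x : Quotient.quot Lam).

Lemma liftK Lam : cancel (@lift Lam) (@cover Lam).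
Proof. by move=> x; rewrite /cover /lift reprK. Qed.

Lemma coverB Lam : {morph @cover Lam : v w / v - w}.
Proof. by move=> v w; exact: (raddfB (\pi_(Quotient.quot Lam))%qT). Qed.

Lemma cover_eq Lam v w : cover Lam v = cover Lam w <-> v - w \in Lam.
Proof. by rewrite Quotient.idealrBE; split=> [/eqP|/eqP]. Qed.

End ComplexTorus.

Section UnitCircle.
Context {R : realType}.

Definition e2pi (t : R) : R[i] := (cos (2 * pi * t) +i* sin (2 * pi * t))%C.

Lemma e2piD s t : e2pi (s + t) = e2pi s * e2pi t.
Proof.
rewrite /e2pi mulrDr cosD sinD; apply/eqP; rewrite eq_complex /=.
by rewrite eqxx /= addrC [X in X + _]mulrC [X in _ + X]mulrC addrC mulrC eqxx.
Qed.

Lemma e2pi0 : e2pi 0 = 1.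
Proof. by rewrite /e2pi mulr0 cos0 sin0. Qed.

Lemma norm_e2pi t : `|e2pi t| = 1.
Proof. by rewrite normc_def /= cos2Dsin2 sqrtr1. Qed.

Lemma e2piV t : (e2pi t)^-1 = e2pi (- t).
Proof.
have e0 : e2pi t != 0 by rewrite -normr_eq0 norm_e2pi oner_eq0.
by apply: (mulfI e0); rewrite mulfV// -e2piD subrr e2pi0.
Qed.

Lemma e2pi_int t : t \is a Num.int -> e2pi t = 1.
Proof.
move=> /intrP[k ->].
have en (n : nat) : e2pi (n%:R : R) = 1.
  elim: n => [|n IHn]; first exact: e2pi0.
  by rewrite -natr1 e2piD IHn mul1r /e2pi mulr1 mulr_natl cos2pi sin2pi.
by case: k => n; rewrite ?NegzE ?mulrNz -?e2piV -pmulrn en ?invr1.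
Qed.

End UnitCircle.

Lemma ImD (R : realType) (z w : R[i]) :
  complex.Im (z + w) = complex.Im z + complex.Im w.
Proof. by case: z; case: w. Qed.

Lemma ImN (R : realType) (z : R[i]) : complex.Im (- z) = - complex.Im z.
Proof. by case: z. Qed.

Section LineBundle.
Context {R : realType} {V : vectType R[i]} (Lam : zmodClosed V).
Implicit Types (u v w : V) (a : R[i]).

(* Line bundles on X = V / Lam, up to isomorphism, in Appell-Humbert form
   L(H, chi): H = c_1(L) is a hermitian form on V whose imaginary part E is
   integral on Lam, and chi is a semicharacter of Lam for H, that is, a map to
   the unit circle with chi(k + l) = chi(k) chi(l) (-1)^E(k, l).  Isomorphism
   is equality of (H, chi). *)
Record line_bundle := LineBundle {
  chern_form : V -> V -> R[i];
  semichar : {l : V | l \in Lam} -> R[i];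
  chern_linear : forall a u v w,
    chern_form (a *: u + v) w = a * chern_form u w + chern_form v w;
  chern_hermitian : forall v w, chern_form w v = ((chern_form v w)^*)%C;
  chern_integral : forall k l, k \in Lam -> l \in Lam ->
    complex.Im (chern_form k l) \is a Num.int;
  semichar_norm : forall l, `|semichar l| = 1;
  semicharD : forall k l m, val m = val k + val l ->
    semichar m =
      semichar k * semichar l * e2pi (complex.Im (chern_form (val k) (val l)) / 2)
}.

Lemma line_bundle_eq (M N : line_bundle) :
  chern_form M = chern_form N -> semichar M = semichar N -> M = N.
Proof.
case: M => H c p1 p2 p3 p4 p5; case: N => H' c' q1 q2 q3 q4 q5 /= eH ec.
rewrite {}eH {}ec in p1 p2 p3 p4 p5 *.
by congr LineBundle; exact: Prop_irrelevance.
Qed.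

Definition alt_form (M : line_bundle) v w : R := complex.Im (chern_form M v w).

Lemma alt_formDl M u v w :
  alt_form M (u + v) w = alt_form M u w + alt_form M v w.
Proof.
by rewrite /alt_form -[X in chern_form M (X + _)]scale1r chern_linear mul1r ImD.
Qed.

Lemma alt_formC M v w : alt_form M w v = - alt_form M v w.
Proof. by rewrite /alt_form chern_hermitian; case: chern_form. Qed.

Lemma alt_formDr M u v w :
  alt_form M u (v + w) = alt_form M u v + alt_form M u w.
Proof. by rewrite alt_formC alt_formDl opprD -!alt_formC. Qed.

#[local] Obligation Tactic := idtac.

Program Definition trivial_bundle : line_bundle :=
  @LineBundle (fun _ _ => 0) (fun=> 1) _ _ _ _ _.
Next Obligation. by move=> * /=; rewrite mulr0 addr0. Qed.
Next Obligation. by move=> * /=; rewrite oppr0. Qed.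
Next Obligation. by move=> * /=; rewrite rpred0. Qed.
Next Obligation. by move=> * /=; rewrite normr1. Qed.
Next Obligation. by move=> * /=; rewrite mul0r e2pi0 !mulr1. Qed.

Program Definition tensor (M N : line_bundle) : line_bundle :=
  @LineBundle (fun v w => chern_form M v w + chern_form N v w)
    (fun l => semichar M l * semichar N l) _ _ _ _ _.
Next Obligation. by move=> * /=; rewrite !chern_linear mulrDr addrACA. Qed.
Next Obligation.
by move=> M N v w /=; rewrite (chern_hermitian M) (chern_hermitian N) rmorphD.
Qed.
Next Obligation. by move=> * /=; rewrite ImD rpredD// chern_integral. Qed.
Next Obligation. by move=> * /=; rewrite normrM !semichar_norm mulr1. Qed.
Next Obligation.
move=> M N k l m klm /=; rewrite (semicharD M klm) (semicharD N klm).
by rewrite ImD mulrDl e2piD mulrACA; congr (_ * _); rewrite mulrACA.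
Qed.

Program Definition dual_bundle (M : line_bundle) : line_bundle :=
  @LineBundle (fun v w => - chern_form M v w) (fun l => (semichar M l)^-1)
    _ _ _ _ _.
Next Obligation. by move=> * /=; rewrite chern_linear opprD mulrN. Qed.
Next Obligation. by move=> M v w /=; rewrite chern_hermitian rmorphN. Qed.
Next Obligation. by move=> * /=; rewrite ImN rpredN chern_integral. Qed.
Next Obligation. by move=> * /=; rewrite normfV semichar_norm invr1. Qed.
Next Obligation.
by move=> M k l m klm /=; rewrite (semicharD M klm) !invfM e2piV ImN mulNr.
Qed.

(* t_v^* L(H, chi) = L(H, chi * exp(2 i pi E(v, -))) *)
Program Definition translate_by (v : V) (M : line_bundle) : line_bundle :=
  @LineBundle (chern_form M) (fun l => semichar M l * e2pi (alt_form M v (val l)))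
    _ _ _ _ _.
Next Obligation. by move=> * /=; rewrite chern_linear. Qed.
Next Obligation. by move=> * /=; rewrite chern_hermitian. Qed.
Next Obligation. by move=> * /=; rewrite chern_integral. Qed.
Next Obligation. by move=> * /=; rewrite normrM semichar_norm norm_e2pi mulr1. Qed.
Next Obligation.
move=> v M k l m klm /=; rewrite (semicharD M klm) klm alt_formDr e2piD.
by rewrite mulrAC [in RHS]mulrACA.
Qed.

Definition translate (x : torus Lam) (M : line_bundle) : line_bundle :=
  translate_by (lift x) M.

Lemma translate_cover v M : translate (cover Lam v) M = translate_by v M.
Proof.
apply: line_bundle_eq => //=; apply: funext => l; congr (_ * _).
have : lift (cover Lam v) - v \in Lam by rewrite -cover_eq liftK.
move=> h; rewrite -[lift _](subrK v) alt_formDl e2piD e2pi_int ?mul1r//.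
by apply: chern_integral => //; exact: (valP l).
Qed.

(* Pic^0(X): the line bundles with vanishing first Chern class *)
Definition Pic0 : Type := {M : line_bundle | chern_form M = fun _ _ => 0}.

HB.instance Definition _ := gen_eqMixin Pic0.
HB.instance Definition _ := gen_choiceMixin Pic0.
HB.instance Definition _ :=
  isPointed.Build Pic0 (exist _ trivial_bundle erefl).

Lemma polarization_subproof (M : line_bundle) (x : torus Lam) :
  chern_form (tensor (translate x M) (dual_bundle M)) = fun _ _ => 0.
Proof. by apply: funext => v; apply: funext => w /=; rewrite subrr. Qed.

Definition polarization_isogeny (M : line_bundle) (x : torus Lam) : Pic0 :=
  exist _ (tensor (translate x M) (dual_bundle M)) (polarization_subproof M x).

Definition Kgroup (M : line_bundle) : set (torus Lam) :=
  [set x | translate x M = M].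

(* By Lefschetz, a line bundle is ample iff its first Chern class is positive
   definite. *)
Definition ample (M : line_bundle) : Prop :=
  forall v, v != 0 -> 0 < complex.Re (chern_form M v v).

End LineBundle.

Section Metric.
Context {R : realType} {V : vectType R[i]} {Lam : zmodClosed V}.
Variable L : line_bundle Lam.

Definition flat_norm (v : V) : R := Num.sqrt (complex.Re (chern_form L v v)).

(* The geodesics of X issuing from 0 are the projections t |-> cover (t v) of
   the straight segments [0, v] of V; such a segment ends at cover v and has
   length |v|. *)
Definition geodesics_to (x : torus Lam) : set V := [set v | cover Lam v = x].

Definition dist0 (x : torus Lam) : R := inf (flat_norm @` geodesics_to x).

Definition ell : R :=
  inf [set flat_norm v | v in
    [set v | Kgroup L (cover Lam v) /\ cover Lam v != 0]].

Definition nearest_points : set (torus Lam) :=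
  [set x | [/\ Kgroup L x, x != 0 & dist0 x = ell]].

Definition nb_shortest_geodesics (x : torus Lam) : nat :=
  #|` fset_set [set v | geodesics_to x v /\ flat_norm v = ell]|.

(* The points of K(L) nearest to 0, each one counted with the number of shortest
   geodesic segments that join it to 0.  The multiplicity is 1 except at the
   points that are joined to 0 by several shortest segments.  It cannot be
   dropped: on V = C, Lam = Z[i], H(v, w) = 2 v w^*, the two nearest points 1/2
   and i/2 are both reached by two shortest segments, the optimal decoder has the
   square with vertices (+-1 +-i)/4 as image, and each of its four sides
   contributes one Gaussian tail to 1 - R_sigma. *)
Definition nb_nearest : nat :=
  (\sum_(x <- fset_set nearest_points) nb_shortest_geodesics x)%N.

Lemma nb_nearest_simple :
  (forall x, nearest_points x -> nb_shortest_geodesics x = 1%N) ->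
  nb_nearest = #|` fset_set nearest_points|.
Proof.
move=> h; rewrite /nb_nearest.
have [fin|nfin] := pselect (finite_set nearest_points); last first.
  by rewrite /fset_set; case: pselect => // _; rewrite big_nil.
rewrite big_seq (eq_bigr (fun=> 1%N)); last first.
  by move=> x; rewrite in_fset_set// inE => /h.
by rewrite -big_seq sum1_size.
Qed.

Definition flat_open (U : set (universal_cover Lam)) : Prop :=
  forall v, U v -> exists2 r : R, 0 < r &
    forall w, flat_norm (w - v) < r -> U w.

Definition flat_opens : set (set (universal_cover Lam)) :=
  [set U | flat_open U].

Definition torus_opens : set (set (torus Lam)) :=
  [set U | flat_open (cover Lam @^-1` U)].

(* A subbasis of the topology of Pic^0(X) = Hom(Lam, U(1)), which is that of
   pointwise convergence on Lam; it has a countable subset that is again a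
   subbasis, so it generates the Borel sigma-algebra. *)
Definition Pic0_subbasis : set (set (Pic0 Lam)) :=
  [set U | exists l z (r : R),
    U = [set M : Pic0 Lam | complex.Re `|semichar (sval M) l - z| < r]].

Definition borel_cover := g_sigma_algebraType flat_opens.
Definition borel_torus := g_sigma_algebraType torus_opens.
Definition borel_Pic0 := g_sigma_algebraType Pic0_subbasis.

Definition decoder (D : borel_Pic0 -> borel_torus) : Prop :=
  measurable_fun setT D /\ forall xi, polarization_isogeny L (D xi) = xi.

Definition robustness (rho : set borel_torus -> \bar R) : \bar R :=
  ereal_sup [set rho (range D) | D in decoder].

End Metric.

Section Gaussian.
Context {R : realType}.

Fixpoint lebesgue_tuple (m : nat) : set (m.-tuple (measurableTypeR R)) -> \bar R :=
  match m with
  | 0%N => \d_ [tuple]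
  | k.+1 => pushforward (lebesgue_measure \x lebesgue_tuple (m := k))%E
      (fun p : measurableTypeR R * k.-tuple (measurableTypeR R) =>
         [tuple of p.1 :: p.2])
  end.

Context {V : vectType R[i]} {Lam : zmodClosed V}.
Variable L : line_bundle Lam.

Definition unitary_frame (b : (dim V).-tuple V) : Prop :=
  forall j k, chern_form L (tnth b j) (tnth b k) = (j == k)%:R.

Definition frame : (dim V).-tuple V := xget [tuple of nseq (dim V) 0] unitary_frame.

Let H := chern_form L.

Let HD u v w : H (u + v) w = H u w + H v w.
Proof. by rewrite -[u in LHS]scale1r /H chern_linear mul1r. Qed.

Let HB u v w : H (u - v) w = H u w - H v w.
Proof. by rewrite addrC -scaleN1r /H chern_linear mulN1r addrC. Qed.

Let HC v w : H w v = ((H v w)^*)%C. Proof. exact: chern_hermitian. Qed.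

Let H0 w : H 0 w = 0. Proof. by rewrite -(subrr 0) HB subrr. Qed.

Let HZ a v w : H (a *: v) w = a * H v w.
Proof. by rewrite -[a *: v]addr0 /H chern_linear -/H H0 addr0. Qed.

Let H_sum n (f : 'I_n -> V) w : H (\sum_i f i) w = \sum_i H (f i) w.
Proof.
by apply: (big_morph (H^~ _)) => [u v|]; [exact: HD|exact: H0].
Qed.

Let Hreal v : H v v = ((complex.Re (H v v))%:C)%C.
Proof.
have := HC v v; case: (H v v) => a b [/eqP].
by rewrite -subr_eq0 opprK -mulr2n mulrn_eq0 /= => /eqP ->.
Qed.

Lemma frame_exists : ample L -> exists b, unitary_frame b.
Proof.
move=> Lpos.
suff /(_ _ (leqnn _)) [s ss sP] : forall k, (k <= dim V)%N ->
    exists2 s : seq V, size s = k & forall i j, (i < k)%N -> (j < k)%N ->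
      H s`_i s`_j = (i == j)%:R.
  have sz : size s == dim V by rewrite ss.
  exists (Tuple sz) => i j; rewrite !(tnth_nth 0) /=.
  exact: sP.
elim=> [_|k IHk kn]; first by exists [::].
have [s ss sP] := IHk (ltnW kn).
have [v vs] : exists v, v \notin span s.
  apply: contrapT => /forallNP h.
  have : (fullv <= span s)%VS.
    by apply/subvP => v _; apply/negPn/negP; exact: h.
  move/dimvS; rewrite dimvf => /leq_trans/(_ (dim_span s)).
  by rewrite ss leqNgt kn.
pose w := v - \sum_(i < k) H v s`_i *: s`_i.
have ws j : (j < k)%N -> H w s`_j = 0.
  move=> jk; rewrite HB H_sum (bigD1 (Ordinal jk))//= HZ sP// eqxx mulr1.
  rewrite big1 ?addr0 ?subrr// => i /negPf ij.
  by rewrite HZ sP// -[_ == _]/(i == Ordinal jk) ij mulr0.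
have w0 : w != 0.
  apply: contraNneq vs => /eqP; rewrite subr_eq0 => /eqP ->.
  by apply: memv_suml => i _; rewrite memvZ// memv_span// mem_nth// ss.
pose c : R := Num.sqrt (complex.Re (H w w)).
have c0 : 0 < c by rewrite sqrtr_gt0 Lpos.
have cs j : (j < k)%N -> H ((c^-1)%:C%C *: w) s`_j = 0.
  by move=> jk; rewrite HZ ws// mulr0.
exists ((c^-1)%:C%C *: w :: s); first by rewrite /= ss.
move=> [|i] [|j] //=; rewrite ?ltnS => ik jk.
- have Hw : H w w = (c ^+ 2)%:C%C.
    by rewrite Hreal sqr_sqrtr// ltW// Lpos.
  rewrite HZ HC HZ Hw -rmorphM conjc_real -rmorphM /= expr2.
  by rewrite mulKf ?gt_eqF// mulVf ?gt_eqF.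
- exact: cs.
- by rewrite HC cs// rmorph0.
- by rewrite sP.
Qed.

Lemma frameP : ample L -> unitary_frame frame.
Proof. by move=> /frame_exists[b bP]; exact: (xgetI _ bP). Qed.

Definition frame_point (t : (dim V + dim V).-tuple (measurableTypeR R)) :
    borel_cover L :=
  \sum_(j < dim V)
    (tnth t (lshift (dim V) j) +i* tnth t (rshift (dim V) j))%C *: tnth frame j.

(* The measure of the volume form of the metric, which is Lebesgue measure in
   the orthonormal real coordinates given by a unitary frame of (V, H), whatever
   the choice of the frame. *)
Definition volume : set (borel_cover L) -> \bar R :=
  pushforward (lebesgue_tuple (m := dim V + dim V)) frame_point.

Definition gaussian_density (sigma : R) (v : V) : R :=
  (2 * pi * sigma ^+ 2) ^- dim V * expR (- (flat_norm L v ^+ 2 / (2 * sigma ^+ 2))).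

Definition gaussian (sigma : R) (A : set (borel_cover L)) : \bar R :=
  (\int[volume]_(v in A) (gaussian_density sigma v)%:E)%E.

Definition gaussian_noise (sigma : R) : set (borel_torus L) -> \bar R :=
  pushforward (gaussian sigma) (cover Lam : borel_cover L -> borel_torus L).

Definition gaussian_robustness (sigma : R) : \bar R :=
  robustness (gaussian_noise sigma).

End Gaussian.

(* Main.v *)
Require Import Defs.
From HB Require Import structures.
From mathcomp Require Import all_boot all_order all_algebra.
From mathcomp Require Import generic_quotient ring_quotient complex.
From mathcomp Require Import finmap all_classical all_reals all_analysis.
From mathcomp Require Import measurable_realfun ring lra.

Import Order.TTheory GRing.Theory Num.Theory.
Import numFieldNormedType.Exports.

Local Open Scope classical_set_scope.
Local Open Scope ring_scope.

Set Implicit Arguments.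
Unset Strict Implicit.
Unset Printing Implicit Defensive.

(** Write |v| for the flat norm, E for the alternating form of [L], and let
    Lam^# be the dual lattice of all v with E(v, Lam) integral, so that K(L)
    is Lam^# / Lam. The isogeny confuses two points of the torus exactly
    when they differ by an element of K(L); the lifts of its nonzero
    elements are the vectors mu of Lam^# outside Lam ([logical]). The least
    |mu| is [ell L], it is attained by finitely many mu ([shortest]), and
    their number is [nb_nearest L] ([nb_nearestE]): this is where counting
    geodesics rather than points matters, since distinct shortest vectors
    may lie over one point of K(L). The two estimates below show that [1 -
    gaussian_robustness L sigma] is [nb_nearest L] times the one-dimensional
    Gaussian tail beyond [ell L / 2], up to a bounded multiple of the
    Gaussian mass of the complement of a ball of radius slightly larger than
    [ell L / 2]. That mass is exponentially smaller ([gaussian_ball_compl],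
    [far_bound]) and the tail is classical ([normal_tail_bounds]).

    Decoders cannot do better ([gaussian_converse]). The image of a decoder
    contains only one point of each K(L)-coset, hence its preimage A in the
    cover is disjoint from all its translates by logical vectors. For a
    shortest mu, let U be the part of the half-space <mu, v> > |mu|^2 / 2
    lying in a ball of radius slightly larger than |mu| / 2. For v in U, at
    least one of v and v - mu is outside A, and v - mu is nearer to the
    origin than v, so the Gaussian density is larger there. The complement
    of A therefore has in U or U - mu at least the mass of U. The sets U and
    U - mu are caps centred near mu / 2 and - mu / 2; for a radius close to
    |mu| / 2 all these caps are disjoint, and their contributions add up.

    Conversely ([gaussian_voronoi], [nearest_decoder]) let W be the set of
    the v that are strictly nearer to 0 than to any logical vector. Two
    points of W never differ by a logical vector, so some decoder has an
    image containing the image of W: lift the dual torus measurably to the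
    cover, and add the first dual vector, in some enumeration, that leads
    into W. A point outside W is either far from the origin or in one of the
    half-spaces <mu, v> >= |mu|^2 / 2 with mu shortest, and the union bound
    concludes.

    The Gaussian measure of a half-space reduces to dimension one because a
    linear form pushes a product of centred Gaussians of equal variance to a
    Gaussian ([integral_gweight_proj]), which follows from the rotation
    invariance of the plane Gaussian by induction on the dimension. *)

Local Notation cover := Defs.cover.

(** * Lebesgue measure on tuples as an iterated integral *)

Section SigmaFiniteOf.
Context d (T : measurableType d) (R : realType) (nu : {measure set T -> \bar R}).
Hypothesis sf : sigma_finite setT nu.

Let nu' : set T -> \bar R := nu.
HB.instance Definition _ := Measure.on nu'.
HB.instance Definition _ := Measure_isSigmaFinite.Build _ _ _ nu' sf.

Lemma sigma_finite_measure_of :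
  exists mu : {sigma_finite_measure set T -> \bar R}, forall A, mu A = nu A.
Proof. by exists nu'. Qed.

End SigmaFiniteOf.

Section LebesgueTuple.
Context {R : realType}.
Local Notation tup m := (m.-tuple (measurableTypeR R)).

Lemma measurable_cons_pair m :
  measurable_fun [set: measurableTypeR R * tup m]
    (fun p => [the tup m.+1 of p.1 :: p.2]).
Proof.
exact: (@measurable_cons _ _ (measurableTypeR R * tup m)%type (measurableTypeR R)
   fst m snd measurable_fst measurable_snd).
Qed.

(** The recursive definition of [lebesgue_tuple] yields bare set functions;
Fubini needs a sigma-finite measure at each stage.  The exhausting boxes are
transported along the measurable bijection between tuples and pairs. *)
Lemma lebesgue_tuple_sigma_finite m :
  exists mu : {sigma_finite_measure set (tup m) -> \bar R},
    forall A, lebesgue_tuple (m := m) A = mu A.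
Proof.
elim: m => [|m [mu muE]].
  by exists (\d_ ([tuple] : tup 0)) => A.
pose f (p : measurableTypeR R * tup m) := [the tup m.+1 of p.1 :: p.2].
have mf : measurable_fun setT f by exact: measurable_cons_pair.
pose g (t : tup m.+1) := (thead t : measurableTypeR R, [tuple of behead t] : tup m).
have mg : measurable_fun setT g.
  apply/measurable_fun_pairP; split; last exact: measurable_behead.
  exact: (@measurable_tnth _ (measurableTypeR R)).
have fK : cancel f g.
  by move=> [x t]; rewrite /f /g/= theadE; congr pair; exact/val_inj.
have [nu' nu'E] : exists nu : {measure set (tup m.+1) -> \bar R},
    nu = pushforward (lebesgue_measure \x mu)%E f :> (set _ -> _).
  by unshelve eexists (pushforward (lebesgue_measure \x mu)%E f).
have sf : sigma_finite setT nu'.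
  pose lm : {sigma_finite_measure set (measurableTypeR R) -> \bar R} :=
    @lebesgue_measure R.
  have /sigma_finiteP[F [TF ndF Foo]] := sigma_finiteT lm.
  have /sigma_finiteP[G [TG ndG Goo]] := sigma_finiteT mu.
  exists (fun n => g @^-1` (F n `*` G n)).
    rewrite -preimage_bigcup (_ : \bigcup_n _ = setT) ?preimage_setT//.
    rewrite -setXTT TF TG predeqE => -[x y]; split.
      by move=> [n _ []/= ? ?]; split; exists n.
    move=> [/= [n _ Fnx] [k _ Gky]]; exists (maxn n k) => //; split.
    - by move: x Fnx; exact/subsetPset/ndF/leq_maxl.
    - by move: y Gky; exact/subsetPset/ndG/leq_maxr.
  move=> n; have [mF Fn] := Foo n; have [mG Gn] := Goo n.
  have mFG : measurable (F n `*` G n) by exact: measurableX.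
  split; first by rewrite -[X in measurable X]setTI; exact: mg.
  have -> : nu' (g @^-1` (F n `*` G n)) = (lm \x mu)%E (F n `*` G n).
    rewrite nu'E /pushforward; congr ((_ \x _)%E _).
    by apply/funext => p; exact: (congr1 (F n `*` G n) (fK p)).
  by rewrite product_measure1E// lte_mul_pinfty// ge0_fin_numE.
have [nu2 nu2E] := sigma_finite_measure_of sf.
exists nu2 => A; rewrite nu2E nu'E /pushforward /=.
by congr ((_ \x _)%E _); apply/funext => B; exact: muE.
Qed.

(** [lebesgue_tuple] with its structure of sigma-finite measure. *)
Definition leb m : {sigma_finite_measure set (tup m) -> \bar R} :=
  projT1 (cid (lebesgue_tuple_sigma_finite m)).

Lemma lebE m : lebesgue_tuple (m := m) = leb m.
Proof. by apply/funext => A; exact: projT2 (cid (lebesgue_tuple_sigma_finite m)) A. Qed.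

Local Open Scope ereal_scope.

Lemma measurable_integral_leb m (F : measurableTypeR R * tup m -> \bar R) :
  measurable_fun [set: measurableTypeR R * tup m] F -> (forall p, 0 <= F p) ->
  measurable_fun setT (fun x => \int[leb m]_t F (x, t)).
Proof. by move=> mF F0; exact: (@measurable_fun_fubini_tonelli_F _ _ _ _ _ (leb m) F). Qed.

Lemma integral_leb0 (F : tup 0 -> \bar R) : \int[leb 0]_t F t = F [tuple].
Proof.
have mF : measurable_fun setT F.
  move=> _ Y mY; rewrite setTI.
  have [h|h] := pselect (F [tuple] \in Y).
    by rewrite (_ : _ @^-1` _ = setT)//; apply/seteqP; split=> // t _ /=;
       rewrite (tuple0 t); exact: set_mem h.
  rewrite (_ : _ @^-1` _ = set0)//; apply/seteqP; split=> // t /=.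
  by rewrite (tuple0 t) => ?; apply: h; exact/mem_set.
rewrite (eq_measure_integral (\d_ ([tuple] : tup 0))); last first.
  by move=> A mA _; rewrite -lebE.
by rewrite integral_dirac//= diracT mul1e.
Qed.

(** Tonelli's theorem for the last stage of the recursion; together with
[integral_leb0] it reduces every integral below to iterated integrals on the
line. *)
Lemma integral_lebS m (F : tup m.+1 -> \bar R) :
  measurable_fun setT F -> (forall t, 0 <= F t) ->
  \int[leb m.+1]_t F t =
  \int[lebesgue_measure]_x \int[leb m]_t F [the tup m.+1 of x :: t].
Proof.
move=> mF F0.
pose f (p : measurableTypeR R * tup m) := [the tup m.+1 of p.1 :: p.2].
have mf : measurable_fun setT f by exact: measurable_cons_pair.
rewrite (eq_measure_integral (pushforward (lebesgue_measure \x leb m) f)); last first.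
  move=> A mA _; rewrite -(lebE m.+1) [LHS]/= /pushforward; congr ((_ \x _)%E _).
  by rewrite lebE.
rewrite ge0_integral_pushforward// preimage_setT.
pose lm : {sigma_finite_measure set (measurableTypeR R) -> \bar R} :=
  @lebesgue_measure R.
rewrite (@fubini_tonelli1 _ _ _ _ R lm (leb m))//.
  exact: (measurableT_comp mF mf).
by move=> p; exact: F0.
Qed.

End LebesgueTuple.

(** * Affine changes of variable on the real line *)

Section RealLine.
Context {R : realType}.
Local Notation mu := (@lebesgue_measure R).
Local Open Scope ereal_scope.

Lemma lebesgue_measure_affine (a b : R) (A : set (measurableTypeR R)) :
  (0 < a)%R -> measurable A ->
  mu A = a%:E * mu ((fun x : measurableTypeR R => (a * x + b)%R) @^-1` A).
Proof.
move=> a0 mA.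
pose f (x : measurableTypeR R) : measurableTypeR R := (a * x + b)%R.
have mf : measurable_fun setT f.
  by apply: measurable_funD => //; exact: measurable_funM.
pose nu : {measure set (measurableTypeR R) -> \bar R} :=
  mscale (NngNum (ltW a0)) (measure_function_pushforward__canonical__measure_function_Measure mu mf).
rewrite (@lebesgue_measure_unique _ nu)// => _ [[x y]] _ <-.
rewrite /nu/= /mscale/= /pushforward.
have -> : f @^-1` `]x, y]%classic = `]((x - b) / a)%R, ((y - b) / a)%R]%classic.
  apply/seteqP; split => z /=; rewrite !in_itv/= /f;
  by rewrite ltr_pdivrMr// ler_pdivlMr// ltrBlDr lerBrDr mulrC.
rewrite !lebesgue_measure_itv/= !lte_fin ltr_pM2r ?invr_gt0// ltrD2r.
case: ifPn => _; last by rewrite mule0.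
by rewrite -!EFinD -EFinM; congr EFin; field; rewrite gt_eqF.
Qed.

Lemma integral_affine (a b : R) (g : R -> \bar R) : (0 < a)%R ->
  measurable_fun setT g -> (forall x, 0 <= g x) ->
  \int[mu]_x g x = a%:E * \int[mu]_x g (a * x + b)%R.
Proof.
move=> a0 mg g0.
pose f (x : measurableTypeR R) : measurableTypeR R := (a * x + b)%R.
have mf : measurable_fun setT f.
  by apply: measurable_funD => //; exact: measurable_funM.
pose pf := measure_function_pushforward__canonical__measure_function_Measure mu mf.
have := @ge0_integral_pushforward _ _ _ _ _ f mf mu setT g measurableT mg (fun _ _ => g0 _).
rewrite preimage_setT => <-.
rewrite -(@ge0_integral_mscale _ _ R pf setT measurableT (NngNum (ltW a0)))//.
by apply: eq_measure_integral => A mA _ /=; exact: lebesgue_measure_affine.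
Qed.

Lemma integral_opp (g : R -> \bar R) :
  measurable_fun setT g -> (forall x, 0 <= g x) ->
  \int[mu]_x g x = \int[mu]_x g (- x)%R.
Proof.
move=> mg g0.
pose f (x : measurableTypeR R) : measurableTypeR R := (- x)%R.
have mf : measurable_fun setT f by exact: oppr_measurable.
have := @ge0_integral_pushforward _ _ _ _ _ f mf mu setT g measurableT mg (fun _ _ => g0 _).
rewrite preimage_setT => <-.
by apply: eq_measure_integral => A mA _ /=; rewrite -lebesgue_measureN.
Qed.

End RealLine.

(** * Rotation invariance of the plane Gaussian *)

Section PlaneGaussian.
Context {R : realType}.
Local Notation mu := (@lebesgue_measure R).
Variable sigma : R.
Hypothesis sigma0 : sigma != 0.
Local Notation N := (normal_pdf 0 sigma).

(** Both sides are the density of the plane Gaussian at one point, written in two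
orthonormal frames: with y = (s z - a x) / b and w = (s x - a z) / b one has
x^2 + y^2 = z^2 + w^2 as soon as s^2 = a^2 + b^2. *)
Lemma normal_pdf_rotation (a b s x z : R) : 0 < b -> s ^+ 2 = a ^+ 2 + b ^+ 2 ->
  N x * N (s / b * z + - (a / b * x)) = N z * N (s / b * x + - (a / b * z)).
Proof.
move=> b0 sE; rewrite !normal_pdfE// mulrACA [in RHS]mulrACA.
congr (_ * _); rewrite /normal_fun -!expRD.
congr expR; rewrite -!mulrDl; congr (_ / _); rewrite !subr0.
apply: (@mulIf _ (b ^+ 2)); first by rewrite expf_neq0// gt_eqF.
have b1 : b != 0 by rewrite gt_eqF.
have E1 u v : (s / b * u + - (a / b * v)) ^+ 2 * b ^+ 2 = (s * u - a * v) ^+ 2.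
  by rewrite -exprMn; congr (_ ^+ 2); field.
rewrite !mulrDl !mulNr !E1.
have -> : x ^+ 2 * b ^+ 2 = x ^+ 2 * (s ^+ 2 - a ^+ 2) by rewrite sE; ring.
have -> : z ^+ 2 * b ^+ 2 = z ^+ 2 * (s ^+ 2 - a ^+ 2) by rewrite sE; ring.
by ring.
Qed.

Local Open Scope ereal_scope.

Lemma measurable_EFin_normal_pdf : measurable_fun setT (EFin \o N).
Proof. by apply/measurable_EFinP; exact: measurable_normal_pdf. Qed.

(** A linear form a x + b y of two independent centred Gaussians is Gaussian.  For
fixed x, the substitution z = (a x + b y) / s turns the integrand into a
function of z times a Gaussian in x; after exchanging the integrals the latter
integrates to 1. *)
Lemma integral_rotation (a b s : R) (f : R -> \bar R) :
  (0 <= b)%R -> (0 <= s)%R -> (s ^+ 2 = a ^+ 2 + b ^+ 2)%R ->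
  measurable_fun setT f -> (forall x, 0 <= f x) ->
  \int[mu]_x \int[mu]_y (f (a * x + b * y)%R * (N x * N y)%:E) =
  \int[mu]_z (f (s * z)%R * (N z)%:E).
Proof.
move=> b0 s0 sE mf f0.
have mN := measurable_EFin_normal_pdf.
have N0 x : 0 <= (N x)%:E by rewrite lee_fin normal_pdf_ge0.
have mlin (c d : R) : measurable_fun setT (fun y : R => (c * y + d)%R).
  by apply: measurable_funD => //; exact: measurable_funM.
have mmul (c : R) : measurable_fun setT (fun y : R => (c * y)%R).
  by exact: measurable_funM.
have [b00|bn0] := eqVneq b 0%R.
  transitivity (\int[mu]_x (f (a * x)%R * (N x)%:E)).
    apply: eq_integral => x _; rewrite b00.
    under eq_integral do rewrite mul0r addr0 EFinM muleA.
    rewrite ge0_integralZl// ?integral_normal_pdf ?mule1//.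
    exact: mule_ge0.
  have [a0|a0] := leP 0%R a.
    by rewrite (_ : a = s)//; apply/eqP; rewrite -(@eqrXn2 _ 2)// sE b00 expr0n addr0.
  rewrite integral_opp; last 2 first.
    - apply: emeasurable_funM => //.
      exact: (measurableT_comp mf (mmul a)).
    - by move=> x; exact: mule_ge0.
  apply: eq_integral => x _.
  have -> : (a * - x = s * x)%R.
    rewrite mulrN -mulNr; congr *%R; apply/eqP.
    by rewrite -(@eqrXn2 _ 2)// ?oppr_ge0 ?ltW// sE b00 expr0n addr0 sqrrN.
  by rewrite !normal_pdfE// /normal_fun !subr0 sqrrN.
have {bn0}b0 : (0 < b)%R by rewrite lt_neqAle eq_sym bn0.
have {}s0 : (0 < s)%R.
  by rewrite lt_neqAle s0 andbT eq_sym -sqrf_eq0 sE gt_eqF// ltr_wpDl ?sqr_ge0 ?exprn_gt0.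
have sb0 : (0 < s / b)%R by rewrite divr_gt0.
have b1 : (b != 0)%R by rewrite gt_eqF.
pose h (p : measurableTypeR R * measurableTypeR R) : \bar R :=
  (s / b)%:E * (f (s * p.2)%R * (N p.2 * N (s / b * p.1 + - (a / b * p.2)))%:E).
have mh : measurable_fun [set: measurableTypeR R * measurableTypeR R] h.
  apply: emeasurable_funM => //; apply: emeasurable_funM.
    apply: (measurableT_comp mf); apply: measurable_funM => //; exact: measurable_snd.
  apply/measurable_EFinP; apply: measurable_funM.
    apply: (measurableT_comp (measurable_normal_pdf _ _)); exact: measurable_snd.
  apply: (measurableT_comp (measurable_normal_pdf _ _)).
  apply: measurable_funD; first by apply: measurable_funM => //; exact: measurable_fst.
  by apply: measurable_funN; apply: measurable_funM => //; exact: measurable_snd.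
have h0 p : 0 <= h p.
  rewrite /h; apply: mule_ge0; first by rewrite lee_fin ltW.
  by apply: mule_ge0 => //; rewrite lee_fin mulr_ge0 ?normal_pdf_ge0.
pose lm : {sigma_finite_measure set (measurableTypeR R) -> \bar R} := mu.
transitivity (\int[lm]_x \int[lm]_z h (x, z)).
  apply: eq_integral => x _.
  rewrite (@integral_affine _ (s / b) (- (a / b * x)))//; last 2 first.
    - apply: emeasurable_funM.
        apply: (measurableT_comp mf); rewrite (_ : (fun y => _) = (fun y : R => b * y + a * x)%R)//.
        by apply/funext => y; rewrite addrC.
      by apply/measurable_EFinP; apply: measurable_funM => //; exact: measurable_normal_pdf.
    - by move=> y; rewrite mule_ge0// lee_fin mulr_ge0// normal_pdf_ge0.
  have -> : (fun y => f (a * x + b * (s / b * y + - (a / b * x)))%R *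
      (N x * N (s / b * y + - (a / b * x)))%:E) =
      (fun y => f (s * y)%R * (N x * N (s / b * y + - (a / b * x)))%:E).
    by apply/funext => y; congr (f _ * _); field.
  set g := (fun y : R => _ * _).
  rewrite -(@ge0_integralZl _ _ R mu setT measurableT g); last 3 first.
    - apply: emeasurable_funM; first exact: (measurableT_comp mf (mmul s)).
      apply/measurable_EFinP; apply: measurable_funM => //.
      exact: (measurableT_comp (measurable_normal_pdf _ _) (mlin _ _)).
    - by move=> y _; apply: mule_ge0 => //; rewrite lee_fin mulr_ge0// normal_pdf_ge0.
    - by rewrite lee_fin ltW.
  apply: eq_integral => z _; rewrite /h /g; congr (_ * _).
  by rewrite (@normal_pdf_rotation a b s x z).
rewrite (@fubini_tonelli _ _ _ _ R lm lm)//.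
apply: eq_integral => z _; rewrite /h/=.
have mNz : measurable_fun setT (fun x => (N (s / b * x + - (a / b * z)))%:E).
  apply/measurable_EFinP.
  exact: (measurableT_comp (measurable_normal_pdf _ _) (mlin _ _)).
transitivity (\int[mu]_x ((f (s * z)%R * (N z)%:E) *
    ((s / b)%:E * (N (s / b * x + - (a / b * z)))%:E))).
  by apply: eq_integral => x _; rewrite [RHS]muleCA; congr (_ * _); rewrite EFinM muleA.
rewrite (@ge0_integralZl _ _ R mu setT measurableT); last 3 first.
- exact: emeasurable_funM.
- by move=> y _; apply: mule_ge0 => //; rewrite lee_fin ltW.
- exact: mule_ge0.
rewrite (@ge0_integralZl _ _ R mu setT measurableT)//; last first.
  by rewrite lee_fin ltW.
rewrite -(@integral_affine _ (s / b) (- (a / b * z)) (EFin \o N))//.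
by rewrite integral_normal_pdf mule1.
Qed.

End PlaneGaussian.

(** * Gaussian weights on tuples *)

Section TupleGaussian.
Context {R : realType}.
Local Notation tup m := (m.-tuple (measurableTypeR R)).
Local Notation mu := (@lebesgue_measure R).

Definition tdot m (a : 'I_m -> R) (t : tup m) : R := \sum_i a i * tnth t i.

Lemma measurable_tdot m (a : 'I_m -> R) : measurable_fun setT (tdot a).
Proof.
apply: measurable_sum => i; apply: measurable_funM => //.
exact: measurable_tnth.
Qed.

Lemma tdot_cons m (a : 'I_m.+1 -> R) x (t : tup m) :
  tdot a [the tup m.+1 of x :: t] = a ord0 * x + tdot (a \o lift ord0) t.
Proof.
rewrite /tdot big_ord_recl; congr (_ + _).
by apply: eq_bigr => i _; rewrite tnthS.
Qed.

Definition tshift m (a : 'I_m -> R) (t : tup m) : tup m :=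
  [tuple tnth t i + a i | i < m].

Lemma measurable_tshift m (a : 'I_m -> R) : measurable_fun setT (tshift a).
Proof.
apply/measurable_fun_tnthP => i.
rewrite (_ : _ \o _ = fun t => tnth t i + a i).
  by apply: measurable_funD => //; exact: measurable_tnth.
by apply/funext => t; rewrite /= tnth_mktuple.
Qed.

Lemma tshift_cons m (a : 'I_m.+1 -> R) x (t : tup m) :
  tshift a [the tup m.+1 of x :: t] =
  [the tup m.+1 of x + a ord0 :: tshift (a \o lift ord0) t].
Proof.
apply: eq_from_tnth => i; rewrite tnth_mktuple.
case: (unliftP ord0 i) => [j ->|->]; last by rewrite !(tnth_nth 0).
by rewrite !tnthS tnth_mktuple.
Qed.

Definition gweight sigma m (t : tup m) : R :=
  \prod_i normal_pdf 0 sigma (tnth t i).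

Lemma gweight_ge0 sigma m (t : tup m) : 0 <= gweight sigma t.
Proof. by apply: prodr_ge0 => i _; exact: normal_pdf_ge0. Qed.

Lemma measurable_gweight sigma m : measurable_fun setT (@gweight sigma m).
Proof.
rewrite /gweight; apply: measurable_prod => i _.
apply: (measurableT_comp (measurable_normal_pdf _ _)).
exact: measurable_tnth.
Qed.

Lemma gweight_cons sigma m x (t : tup m) :
  gweight sigma [the tup m.+1 of x :: t] = normal_pdf 0 sigma x * gweight sigma t.
Proof.
rewrite /gweight big_ord_recl; congr (_ * _).
by apply: eq_bigr => i _; rewrite tnthS.
Qed.

Lemma gweightE sigma m (t : tup m) : sigma != 0 ->
  gweight sigma t =
  normal_peak sigma ^+ m * expR (- (\sum_i tnth t i ^+ 2) / (sigma ^+ 2 *+ 2)).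
Proof.
move=> s0; rewrite /gweight; under eq_bigr do rewrite normal_pdfE//.
rewrite big_split/= prodr_const card_ord; congr (_ * _).
rewrite -expR_sum -sumrN mulr_suml; congr expR.
by apply: eq_bigr => i _; rewrite subr0.
Qed.

Local Open Scope ereal_scope.

Lemma measurable_cons_sec m (F : tup m.+1 -> \bar R) (x : R) :
  measurable_fun setT F -> measurable_fun setT (fun t : tup m => F [the tup m.+1 of x :: t]).
Proof.
move=> mF; apply: (measurableT_comp mF).
by apply: measurable_cons => //; exact: measurable_id.
Qed.

Lemma integral_leb_shift m (a : 'I_m -> R) (F : tup m -> \bar R) :
  measurable_fun setT F -> (forall t, 0 <= F t) ->
  \int[leb m]_t F (tshift a t) = \int[leb m]_t F t.
Proof.
elim: m a F => [|m IH] a F mF F0.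
  by rewrite !integral_leb0; congr F; apply: eq_from_tnth => -[].
rewrite !integral_lebS//; last exact: (measurableT_comp mF (measurable_tshift a)).
rewrite [RHS](@integral_affine _ 1 (a ord0))//; last 2 first.
- apply: (@measurable_integral_leb _ _ (fun p => F [the tup m.+1 of p.1 :: p.2])).
    exact: (measurableT_comp mF (@measurable_cons_pair R m)).
  by [].
- by move=> x; apply: integral_ge0.
rewrite mul1e; apply: eq_integral => x _; rewrite mul1r.
under eq_integral do rewrite tshift_cons.
rewrite (IH (a \o lift ord0) (fun t => F [the tup m.+1 of (x + a ord0)%R :: t]))//.
exact: measurable_cons_sec.
Qed.

(** The law of a linear form under the product of Gaussians of variance sigma^2 is the
centred Gaussian of standard deviation s * sigma, s being the Euclidean norm of
the coefficients.  Each induction step merges the first coordinate with the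
Gaussian obtained from the others by a plane rotation. *)
Lemma integral_gweight_proj sigma m (a : 'I_m -> R) s (f : R -> \bar R) :
  sigma != 0%R -> (0 <= s)%R -> (s ^+ 2 = \sum_i a i ^+ 2)%R ->
  measurable_fun setT f -> (forall x, 0 <= f x) ->
  \int[leb m]_t (f (tdot a t) * (gweight sigma t)%:E) =
  \int[mu]_x (f (s * x)%R * (normal_pdf 0 sigma x)%:E).
Proof.
move=> sigma0; have mN := @measurable_EFin_normal_pdf R sigma.
elim: m a s f => [|m IH] a s f s0 sE mf f0.
  have -> : s = 0%R by apply/eqP; rewrite -sqrf_eq0 sE big_ord0.
  rewrite integral_leb0 /tdot /gweight !big_ord0 mule1.
  under eq_integral do rewrite mul0r.
  rewrite ge0_integralZl// ?integral_normal_pdf ?mule1// => x _.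
  by rewrite lee_fin normal_pdf_ge0.
rewrite integral_lebS; last 2 first.
- apply: emeasurable_funM; first exact: (measurableT_comp mf (measurable_tdot a)).
  by apply/measurable_EFinP; exact: measurable_gweight.
- by move=> t; rewrite mule_ge0// lee_fin gweight_ge0.
pose s' : R := Num.sqrt (\sum_i (a \o lift ord0) i ^+ 2).
have s'E : (s' ^+ 2 = \sum_i (a \o lift ord0) i ^+ 2)%R.
  by rewrite sqr_sqrtr// sumr_ge0// => i _; exact: sqr_ge0.
have sE2 : (s ^+ 2 = a ord0 ^+ 2 + s' ^+ 2)%R.
  by rewrite sE big_ord_recl s'E.
rewrite -(integral_rotation sigma0 (sqrtr_ge0 _) s0 sE2 mf f0).
apply: eq_integral => x _.
have mfx : measurable_fun setT (fun y => f (a ord0 * x + y)%R).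
  by apply: (measurableT_comp mf); exact: measurable_funD.
under eq_integral do rewrite tdot_cons gweight_cons EFinM muleCA.
rewrite ge0_integralZl//; last 3 first.
- apply: emeasurable_funM; first exact: (measurableT_comp mfx (measurable_tdot _)).
  by apply/measurable_EFinP; exact: measurable_gweight.
- by move=> t _; rewrite mule_ge0// lee_fin gweight_ge0.
- by rewrite lee_fin normal_pdf_ge0.
rewrite (IH (a \o lift ord0) s' (fun y => f (a ord0 * x + y)%R))// ?sqrtr_ge0//.
under [RHS]eq_integral do rewrite EFinM muleCA.
rewrite [RHS]ge0_integralZl//.
- apply: emeasurable_funM => //; apply: (measurableT_comp mfx).
  exact: measurable_funM.
- by move=> t _; rewrite mule_ge0// lee_fin normal_pdf_ge0.
- by rewrite lee_fin normal_pdf_ge0.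
Qed.

End TupleGaussian.

(** * The Gaussian tail on a half-line *)

Section GaussianTail.
Context {R : realType}.
Local Notation mu := (@lebesgue_measure R).

Let h (k x : R) := x^-1 * expR (- (x ^+ 2 * k)).

Let is_derive_h (k x : R) : x != 0 ->
  is_derive x 1 (h k) (- (x ^- 2 + k *+ 2) * expR (- (x ^+ 2 * k))).
Proof.
move=> x0.
have dV : is_derive x 1 (fun y : R => y^-1) (- x ^- 2).
  have := @is_deriveV R id x 1 1 x0 (is_derive_id _ _).
  by rewrite /= -[X in is_derive _ _ _ X]/(- x ^- 2 * 1) mulr1.
have dq : is_derive x 1 (fun y : R => - (y ^+ 2 * k)) (- (x *+ 2 * k)).
  apply: is_derive_eq.
  by rewrite /GRing.scale/=; ring.
have dE : is_derive x 1 (fun y : R => expR (- (y ^+ 2 * k)))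
    (- (x *+ 2 * k) * expR (- (x ^+ 2 * k))).
  rewrite mulrC.
  exact: (@is_derive1_comp R expR (fun y : R => - (y ^+ 2 * k)) x _ _ (is_derive_expR _) dq).
apply: is_derive_eq; rewrite /GRing.scale/=.
by field.
Qed.

(** The function - (sigma^2 / x) N(x), for N the Gaussian density, is a primitive of
N(x) (1 + sigma^2 / x^2), so the integral of the latter over [c, +oo[ is exactly
(sigma^2 / c) N(c) = p; the extra factor lies between 1 and 1 + sigma^2 / c^2. *)
Lemma normal_tail_bounds (sigma c : R) : 0 < sigma -> 0 < c ->
  let q := (\int[mu]_(x in `[c, +oo[) (normal_pdf 0 sigma x)%:E)%E in
  let p := sigma / (c * Num.sqrt (2 * pi)) * expR (- (c ^+ 2 / (2 * sigma ^+ 2))) in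
  (q <= p%:E /\ p%:E <= (1 + sigma ^+ 2 / c ^+ 2)%:E * q)%E.
Proof.
move=> s0 c0 q p.
have sn0 : sigma != 0 by rewrite gt_eqF.
pose k : R := (sigma ^+ 2 *+ 2)^-1.
pose C : R := - (sigma ^+ 2 * normal_peak sigma).
pose F x := C * h k x.
pose f x := normal_pdf 0 sigma x * (1 + sigma ^+ 2 / x ^+ 2).
have NE x : normal_pdf 0 sigma x = normal_peak sigma * expR (- (x ^+ 2 * k)).
  by rewrite normal_pdfE// /normal_fun subr0 mulNr.
have dF (x : R) : x != 0 -> is_derive x 1 F (f x).
  move=> x0.
  have dh := is_derive_h k x0.
  rewrite /F; apply: is_derive_eq.
  rewrite /GRing.scale/= /f NE /C /k; field.
  by rewrite x0 sn0.
have f0 x : 0 <= f x.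
  by rewrite mulr_ge0 ?normal_pdf_ge0// addr_ge0// divr_ge0 ?sqr_ge0.
have cN0 x : c <= x -> x != 0 by move=> /(lt_le_trans c0) /gt_eqF ->.
have cf (x : R) : x != 0 -> {for x, continuous f}.
  move=> x0; apply: cvgM; first exact: continuous_normal_pdf.
  apply: cvgD; first exact: cvg_cst.
  apply: cvgM; first exact: cvg_cst.
  apply: cvgV; first by rewrite expf_neq0.
  exact: exprn_continuous.
have cwf : {within `[c, +oo[, continuous f}.
  apply: continuous_in_subspaceT => x; rewrite inE/= in_itv/= andbT => cx.
  by apply: cf; exact: cN0.
have hp : p = (sigma ^+ 2 / c) * normal_pdf 0 sigma c.
  rewrite NE /normal_peak /p.
  rewrite -mulrnAr -[pi *+ 2]mulr_natl (@sqrtrM _ (sigma ^+ 2)) ?sqr_ge0// sqrtr_sqr gtr0_norm//.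
  have -> : c ^+ 2 / (2 * sigma ^+ 2) = c ^+ 2 * k by rewrite /k -[_ ^+ 2 *+ 2]mulr_natl.
  rewrite !mulrA; congr (_ * _).
  by field; rewrite sn0 !gt_eqF// sqrtr_gt0 mulr_gt0// pi_gt0.
have int_f : (\int[mu]_(x in `[c, +oo[) (f x)%:E)%E = p%:E.
  rewrite (@ge0_continuous_FTC2y _ f F c 0)//.
  - rewrite sub0e -EFinN; congr EFin; rewrite hp NE /F /C /h.
    by field; rewrite gt_eqF.
  - rewrite /F -(mulr0 C); apply: cvgM; first exact: cvg_cst.
    apply: (@squeeze_cvgr _ _ _ _ (fun=> 0) (fun x : R => x^-1)).
    + near=> x.
      have x0 : 0 < x by near: x; exact: nbhs_pinfty_gt.
      rewrite /h mulr_ge0 ?invr_ge0 ?expR_ge0 ?(ltW x0)//=.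
      rewrite ler_piMr ?invr_ge0 ?(ltW x0)// -[leRHS]expR0 ler_expR oppr_le0.
      by rewrite mulr_ge0 ?sqr_ge0// invr_ge0 mulrn_wge0// sqr_ge0.
    + exact: cvg_cst.
    + by apply/gtr0_cvgV0; [exact: nbhs_pinfty_gt|exact: cvg_id].
  - by move=> x cx; have [] := dF x (cN0 x (ltW cx)).
  - apply: cvg_at_right_filter.
    have [dFc _] := dF c (cN0 c (lexx _)).
    by apply: differentiable_continuous; apply/derivable1_diffP.
  - move=> x; rewrite in_itv/= andbT => cx.
    by rewrite derive1E; have [_ ->] := dF x (cN0 x (ltW cx)).
have mN := measurable_normal_pdf (0:R) sigma.
have mf : measurable_fun `[c, +oo[%classic f.
  exact: subspace_continuous_measurable_fun.
rewrite -int_f; split.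
  apply: ge0_le_integral => //.
  - by move=> x _; rewrite lee_fin normal_pdf_ge0.
  - by apply/measurable_EFinP; exact: measurable_funTS.
  - by apply/measurable_EFinP.
  - move=> x _; rewrite lee_fin ler_peMr ?normal_pdf_ge0// lerDl.
    by rewrite divr_ge0 ?sqr_ge0.
rewrite -ge0_integralZl//; last 3 first.
- by apply/measurable_EFinP; exact: measurable_funTS.
- by move=> x _; rewrite lee_fin normal_pdf_ge0.
- by rewrite lee_fin addr_ge0// divr_ge0 ?sqr_ge0.
apply: ge0_le_integral => //.
- by move=> x _; rewrite lee_fin.
- by apply/measurable_EFinP.
- by apply/measurable_EFinP; apply: measurable_funM => //; exact: measurable_funTS.
- move=> x /=; rewrite in_itv/= andbT => cx; rewrite -EFinM lee_fin /f mulrC.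
  rewrite ler_wpM2r ?normal_pdf_ge0// lerD2l ler_wpM2l ?sqr_ge0//.
  have x0 : 0 < x := lt_le_trans c0 cx.
  by rewrite lef_pV2 ?posrE ?exprn_gt0// ler_pXn2r// nnegrE ltW.
Unshelve. all: end_near.
Qed.

End GaussianTail.

(** * Orthonormal real coordinates on the cover *)

Section FrameCoordinates.
Context {R : realType} {V : vectType R[i]} {Lam : zmodClosed V}.
Variable L : line_bundle Lam.
Let H := chern_form L.
Local Notation n := (dim V).

Definition ip (v w : V) : R := complex.Re (chern_form L v w).

Lemma chern_formDl u v w : H (u + v) w = H u w + H v w.
Proof. by rewrite -[u in LHS]scale1r /H chern_linear mul1r. Qed.

Lemma chern_form0l w : H 0 w = 0.
Proof. by apply: (addrI (H 0 w)); rewrite -chern_formDl !addr0. Qed.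

Lemma chern_formZl a v w : H (a *: v) w = a * H v w.
Proof. by rewrite -[a *: v]addr0 /H chern_linear -/H chern_form0l addr0. Qed.

Lemma chern_formNl v w : H (- v) w = - H v w.
Proof. by rewrite -scaleN1r chern_formZl mulN1r. Qed.

Lemma chern_formC v w : H w v = ((H v w)^*)%C.
Proof. exact: chern_hermitian. Qed.

Lemma chern_form_suml (I : Type) (r : seq I) (f : I -> V) w :
  H (\sum_(i <- r) f i) w = \sum_(i <- r) H (f i) w.
Proof.
by apply: (big_morph (H^~ w)) => [u v|]; [exact: chern_formDl|exact: chern_form0l].
Qed.

Lemma ipDl u v w : ip (u + v) w = ip u w + ip v w.
Proof. by rewrite /ip -/H chern_formDl; case: (H u w) => ? ?; case: (H v w). Qed.

Lemma ipNl v w : ip (- v) w = - ip v w.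
Proof. by rewrite /ip -/H chern_formNl; case: (H v w). Qed.

Lemma ipC v w : ip v w = ip w v.
Proof. by rewrite /ip -/H chern_formC; case: (H w v). Qed.

Lemma ipDr u v w : ip w (u + v) = ip w u + ip w v.
Proof. by rewrite !(ipC w) ipDl. Qed.

Lemma ipNr v w : ip w (- v) = - ip w v.
Proof. by rewrite !(ipC w) ipNl. Qed.

Lemma ipBl u v w : ip (u - v) w = ip u w - ip v w.
Proof. by rewrite ipDl ipNl. Qed.

Lemma ipBr u v w : ip w (u - v) = ip w u - ip w v.
Proof. by rewrite ipDr ipNr. Qed.

Lemma ip0l w : ip 0 w = 0.
Proof. by rewrite /ip -/H chern_form0l. Qed.

Lemma ip_subb u v : ip (u - v) (u - v) = ip u u - ip u v *+ 2 + ip v v.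
Proof. by rewrite ipBl !ipBr (ipC v u); ring. Qed.

Hypothesis L_ample : ample L.

Lemma ip_ge0 v : 0 <= ip v v.
Proof.
have [->|v0] := eqVneq v 0; first by rewrite ip0l.
by rewrite ltW// L_ample.
Qed.

Lemma ip_gt0 v : v != 0 -> 0 < ip v v.
Proof. exact: L_ample. Qed.

Lemma flat_normE v : flat_norm L v ^+ 2 = ip v v.
Proof. by rewrite sqr_sqrtr// ip_ge0. Qed.

Let fP := frameP L_ample.
Let f (j : 'I_n) := tnth (frame L) j.

(** A unitary family is free, and it has as many elements as the dimension. *)
Lemma frame_basis : basis_of fullv (frame L).
Proof.
rewrite basisEfree subvf dimvf size_tuple leqnn !andbT.
apply/freeP => k k0 i.
have := congr1 (fun v => H v (f i)) k0.
rewrite chern_form_suml chern_form0l (bigD1 i)//= chern_formZl -tnth_nth.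
rewrite [H _ _]fP eqxx mulr1 big1 ?addr0// => j ji.
by rewrite chern_formZl -tnth_nth [H _ _]fP (negPf ji) mulr0.
Qed.

Lemma frame_expansion v : v = \sum_j H v (f j) *: f j.
Proof.
have vE := coord_basis frame_basis (memvf v).
rewrite [LHS]vE; apply: eq_bigr => i _; rewrite -tnth_nth; congr (_ *: _).
rewrite {2}vE chern_form_suml (bigD1 i)//= chern_formZl -tnth_nth.
rewrite [H _ _]fP eqxx mulr1 big1 ?addr0// => j ji.
by rewrite chern_formZl -tnth_nth [H _ _]fP (negPf ji) mulr0.
Qed.

(** Real parts first, then imaginary parts: the order used by [frame_point]. *)
Definition real_coord (i : 'I_(n + n)) (v : V) : R :=
  match fintype.split i with
  | inl j => complex.Re (chern_form L v (tnth (frame L) j))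
  | inr j => complex.Im (chern_form L v (tnth (frame L) j))
  end.

Lemma real_coord_lshift j v : real_coord (lshift n j) v = complex.Re (H v (f j)).
Proof. by rewrite /real_coord; rewrite -[lshift n j]/(unsplit (inl j)) unsplitK. Qed.

Lemma real_coord_rshift j v : real_coord (rshift n j) v = complex.Im (H v (f j)).
Proof. by rewrite /real_coord -[rshift n j]/(unsplit (inr j)) unsplitK. Qed.

Definition real_coords (v : V) : (n + n).-tuple (measurableTypeR R) :=
  [tuple real_coord i v | i < n + n].

Lemma real_coordsK : cancel real_coords (@frame_point R V Lam L).
Proof.
move=> v; rewrite /frame_point [RHS]frame_expansion; apply: eq_bigr => j _.
rewrite !tnth_mktuple real_coord_lshift real_coord_rshift.
by case: (H v _).
Qed.

Lemma real_coord_frame_point i t : real_coord i (frame_point L t) = tnth t i.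
Proof.
have Hf j : H (frame_point L t) (f j) =
    (tnth t (lshift n j) +i* tnth t (rshift n j))%C.
  rewrite /frame_point chern_form_suml (bigD1 j)//= chern_formZl.
  rewrite [H _ _]fP eqxx mulr1 big1 ?addr0// => k kj.
  by rewrite chern_formZl [H _ _]fP (negPf kj) mulr0.
rewrite -(splitK i); case: (fintype.split i) => j /=.
  by rewrite real_coord_lshift Hf.
by rewrite real_coord_rshift Hf.
Qed.

Lemma frame_pointK : cancel (@frame_point R V Lam L) real_coords.
Proof.
by move=> t; apply: eq_from_tnth => i; rewrite tnth_mktuple real_coord_frame_point.
Qed.

Lemma real_coordD i v w : real_coord i (v + w) = real_coord i v + real_coord i w.
Proof.
rewrite /real_coord; case: fintype.split => j; rewrite -/H chern_formDl;
by case: (H v _) => ? ?; case: (H w _).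
Qed.

Lemma real_coordN i v : real_coord i (- v) = - real_coord i v.
Proof.
by rewrite /real_coord; case: fintype.split => j; rewrite -/H chern_formNl; case: (H v _).
Qed.

Lemma ip_coords v w : ip v w = \sum_i real_coord i v * real_coord i w.
Proof.
rewrite big_split_ord/= -big_split/= /ip -/H {1}(frame_expansion v) chern_form_suml.
have -> : complex.Re (\sum_i H (H v (f i) *: f i) w) =
    \sum_i complex.Re (H (H v (f i) *: f i) w).
  by apply: (big_morph (@complex.Re R)) => [[? ?] [? ?]|].
apply: eq_bigr => j _.
rewrite chern_formZl (chern_formC w) !real_coord_lshift !real_coord_rshift.
by case: (H v _) => a b; case: (H w _) => c d /=; ring.
Qed.

Lemma frame_point_shift w t :
  frame_point L (tshift (real_coord^~ w) t) = frame_point L t + w.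
Proof.
apply: (can_inj real_coordsK); apply: eq_from_tnth => i.
by rewrite !tnth_mktuple real_coordD !real_coord_frame_point tnth_mktuple.
Qed.

Lemma ip_frame_point w t : ip w (frame_point L t) = tdot (real_coord^~ w) t.
Proof.
by rewrite ip_coords; apply: eq_bigr => i _; rewrite real_coord_frame_point.
Qed.

End FrameCoordinates.

(** * Borel sets of the cover in coordinates *)

Section MeasurableCoordinates.
Context {R : realType}.
Local Notation tup m := (m.-tuple (measurableTypeR R)).

Lemma measurable_tuple_box m (q : 'I_m -> R) (e : R) :
  measurable [set s : tup m | forall i, `|tnth s i - q i| < e].
Proof.
have -> : [set s : tup m | forall i, `|tnth s i - q i| < e] =
    \bigcap_(i in [set: 'I_m]) ((@tnth _ _)^~ i @^-1` `](q i - e), (q i + e)[%classic).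
  apply/seteqP; split => s /= h i.
    by move=> _ /=; rewrite in_itv/= -ltr_distl.
  by have := h i Logic.I; rewrite /= in_itv/= -ltr_distl.
apply: fin_bigcap_measurable => // i _.
by rewrite -[X in measurable X]setTI; apply: measurable_tnth.
Qed.

(** A countable union of boxes with rational centres exhausts an open set; openness
is spelled out with squared distances. *)
Lemma measurable_tuple_open m (U : set (tup m)) :
  (forall t, U t -> exists2 r : R, 0 < r &
     forall s : tup m, \sum_i (tnth s i - tnth t i) ^+ 2 < r -> U s) ->
  measurable U.
Proof.
move=> Uo.
pose B (p : {ffun 'I_m -> rat} * nat) :=
  [set s : tup m | forall i, `|tnth s i - ratr (p.1 i)| < p.2.+1%:R^-1 ].
pose C p := if pselect (B p `<=` U) then B p else set0.
have -> : U = \bigcup_p C p.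
  apply/seteqP; split => [t Ut|t [p _]]; last first.
    by rewrite /C; case: pselect => [BU /BU|_ []].
  have [r r0 rU] := Uo t Ut.
  have r'0 : 0 < r / (4 * m%:R + 1) by rewrite divr_gt0// ltr_wpDl// mulr_ge0.
  (* A box of half-width e <= 1 containing t has its points at squared distance at
  most m (2 e)^2 <= 4 m e from t. *)
  have [k] := ltr_add_invr r'0; rewrite add0r => kr.
  set e : R := k.+1%:R^-1 in kr.
  have e0 : 0 < e by rewrite invr_gt0.
  have e1 : e <= 1 by rewrite invf_le1// ler1n.
  have hq i : {q : rat | `|tnth t i - ratr q| < e}.
    apply: cid; have : tnth t i - e < tnth t i + e by rewrite ltrBlDr -addrA ltrDl addr_gt0.
    move=> /rat_in_itvoo[q]; rewrite in_itv/= -ltr_distl distrC => ?.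
    by exists q.
  pose q : {ffun 'I_m -> rat} := [ffun i => sval (hq i)].
  exists (q, k) => //; rewrite /C.
  have Bt : B (q, k) t by move=> i /=; rewrite ffunE; exact: svalP (hq i).
  case: pselect => // nBU; exfalso; apply: nBU => s Bs; apply: rU.
  have le_i i : (tnth s i - tnth t i) ^+ 2 <= 4 * e.
    have : `|tnth s i - tnth t i| <= 2 * e.
      rewrite (_ : _ - _ = (tnth s i - ratr (q i)) - (tnth t i - ratr (q i))); last by ring.
      rewrite (le_trans (ler_normB _ _))// mulr2n mulrDl mul1r.
      by apply: lerD; apply: ltW; [exact: Bs|exact: Bt].
    move=> h; rewrite -real_normK ?num_real//.
    apply: (@le_trans _ _ ((2 * e) ^+ 2)).
      by rewrite ler_pXn2r// nnegrE// mulr_ge0// ltW.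
    by rewrite exprMn expr2 -natrM ler_wpM2l// expr2 ler_piMr// ltW.
  apply: (@le_lt_trans _ _ (\sum_(i < m) 4 * e)); first exact: ler_sum.
  rewrite sumr_const card_ord (_ : 4 * e *+ m = e * (4 * m%:R)); last by rewrite -[LHS]mulr_natr; ring.
  move: kr; rewrite ltr_pdivlMr ?ltr_wpDl ?mulr_ge0// => kr.
  by apply: le_lt_trans kr; apply: ler_wpM2l; [exact: ltW|rewrite lerDl].
apply: countable_bigcupT_measurable => // p; rewrite /C.
by case: pselect => [?|?]; [exact: measurable_tuple_box|exact: measurable0].
Qed.

Context {V : vectType R[i]} {Lam : zmodClosed V}.
Variable L : line_bundle Lam.
Hypothesis L_ample : ample L.

Lemma flat_openP (U : set V) : flat_open L U <->
  forall v, U v -> exists2 r : R, 0 < r & forall w, ip L (w - v) (w - v) < r -> U w.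
Proof.
split=> Uo v /Uo[r r0 rU].
  exists (r ^+ 2); first by rewrite exprn_gt0.
  move=> w; rewrite -flat_normE// => h; apply: rU.
  by rewrite -(@ltr_pXn2r _ 2)// nnegrE ?sqrtr_ge0 ?(ltW r0).
exists (Num.sqrt r); first by rewrite sqrtr_gt0.
by move=> w h; apply: rU; rewrite -ltr_sqrt.
Qed.

(** With [measurable_real_coords], this identifies the Borel sigma-algebra of the
cover with that of the tuples of coordinates. *)
Lemma measurable_frame_point : measurable_fun setT (@frame_point R V Lam L).
Proof.
apply: (@measurability _ _ _ (borel_cover L) _ _ (flat_opens L) erefl).
move=> _ [U /flat_openP Uo <-]; rewrite setTI.
apply: measurable_tuple_open => t Ut.
have [r r0 rU] := Uo _ Ut; exists r => // s; rewrite /preimage/= => sr.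
apply: rU; rewrite ip_coords//; apply: le_lt_trans sr.
rewrite le_eqVlt; apply/orP; left; apply/eqP; apply: eq_bigr => i _.
by rewrite real_coordD// real_coordN// !real_coord_frame_point// -expr2.
Qed.

Lemma measurable_real_coord i :
  measurable_fun setT (real_coord L i : borel_cover L -> R).
Proof.
apply: (measurability _ (RGenOInfty.measurableE R)).
move=> _ [_ [c ->] <-]; rewrite setTI; apply: sub_sigma_algebra.
apply/flat_openP => v; rewrite /preimage/= in_itv/= andbT => cv.
exists ((real_coord L i v - c) ^+ 2); first by rewrite exprn_gt0// subr_gt0.
move=> w h; rewrite /= in_itv/= andbT.
have : (real_coord L i (w - v)) ^+ 2 < (real_coord L i v - c) ^+ 2.
  apply: le_lt_trans h; rewrite ip_coords// (bigD1 i)//= -expr2 lerDl sumr_ge0// => j _.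
  by rewrite -expr2 sqr_ge0.
rewrite -ltr_sqrt ?exprn_gt0 ?subr_gt0// !sqrtr_sqr [ltRHS]gtr0_norm ?subr_gt0//.
by rewrite real_coordD// real_coordN// ltr_norml => /andP[+ _]; rewrite opprB ltrD2r.
Qed.

Lemma measurable_real_coords :
  measurable_fun setT (real_coords L : borel_cover L -> _).
Proof.
apply/measurable_fun_tnthP => i.
rewrite (_ : _ \o _ = real_coord L i); first exact: measurable_real_coord.
by apply/funext => v /=; rewrite tnth_mktuple.
Qed.

Lemma measurable_ip (f g : borel_cover L -> borel_cover L) :
  measurable_fun setT f -> measurable_fun setT g ->
  measurable_fun setT (fun v => ip L (f v) (g v)).
Proof.
move=> mf mg; rewrite (_ : (fun v => _) =
    fun v => \sum_i real_coord L i (f v) * real_coord L i (g v)); last first.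
  by apply/funext => v; exact: ip_coords.
apply: measurable_sum => i; apply: measurable_funM.
  exact: (measurableT_comp (measurable_real_coord i) mf).
exact: (measurableT_comp (measurable_real_coord i) mg).
Qed.

Lemma measurable_translation (w : V) :
  measurable_fun setT (fun v : borel_cover L => (v + w : borel_cover L)).
Proof.
rewrite (_ : (fun v => _) = frame_point L \o tshift ((real_coord L)^~ w) \o real_coords L).
  apply: measurableT_comp; last exact: measurable_real_coords.
  exact: (measurableT_comp measurable_frame_point (measurable_tshift _)).
by apply/funext => v /=; rewrite frame_point_shift// real_coordsK.
Qed.

End MeasurableCoordinates.

(** * Gaussian measure of half-spaces, translates and complements of balls *)

Section Density.
Local Open Scope ereal_scope.
Context d (T : measurableType d) (R : realType).
Variables (mu : {measure set T -> \bar R}) (g : T -> R).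
Hypotheses (mg : measurable_fun setT g) (g0 : forall x, (0 <= g x)%R).
Hypothesis g1 : \int[mu]_x (g x)%:E = 1.

Let nu (A : set T) := \int[mu]_(x in A) (g x)%:E.

Let nu0 : nu set0 = 0. Proof. exact: integral_set0. Qed.

Let nu_ge0 A : 0 <= nu A.
Proof. by apply: integral_ge0 => x _; rewrite lee_fin. Qed.

Let nu_sigma_additive : semi_sigma_additive nu.
Proof.
move=> F mF tF mUF; rewrite /nu ge0_integral_bigcup//; last 2 first.
- by apply/measurable_EFinP; exact: measurable_funTS.
- by move=> x _; rewrite lee_fin.
apply: is_cvg_ereal_nneg_natsum_cond => n _ _.
by apply: integral_ge0 => x _; rewrite lee_fin.
Qed.

HB.instance Definition _ :=
  isMeasure.Build _ _ _ nu nu0 nu_ge0 nu_sigma_additive.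
HB.instance Definition _ := Measure_isProbability.Build _ _ R nu g1.

Lemma probability_of_density :
  exists P : probability T R, forall A, P A = \int[mu]_(x in A) (g x)%:E.
Proof. by exists nu. Qed.

End Density.

Section GaussianFacts.
Context {R : realType} {V : vectType R[i]} {Lam : zmodClosed V}.
Variable L : line_bundle Lam.
Hypothesis L_ample : ample L.
Local Notation n := (dim V).
Local Notation mu := (@lebesgue_measure R).

Lemma volume_measure :
  exists vol : {measure set (borel_cover L) -> \bar R},
    @volume R V Lam L = vol :> (set _ -> _).
Proof.
have mf := measurable_frame_point L_ample.
unshelve eexists (pushforward (leb (n + n)) (@frame_point R V Lam L)) => //.
by rewrite /volume lebE.
Qed.

Lemma gaussian_density_ge0 sigma v : 0 <= gaussian_density L sigma v.
Proof.
by rewrite mulr_ge0 ?expR_ge0// invr_ge0 exprn_ge0// mulr_ge0 ?sqr_ge0// mulr_ge0 ?pi_ge0.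
Qed.

Lemma gaussian_density_frame_point sigma t : sigma != 0 ->
  gaussian_density L sigma (frame_point L t) = gweight sigma t.
Proof.
move=> s0; rewrite gweightE// /gaussian_density; congr (_ * _).
  rewrite /normal_peak exprVn exprD -exprMn -expr2 sqr_sqrtr.
    by congr ((_ ^+ _)^-1); rewrite -mulr_natl; ring.
  by rewrite mulrn_wge0// mulr_ge0 ?sqr_ge0 ?pi_ge0.
congr expR; rewrite flat_normE// ip_coords// mulNr; congr (- (_ / _)).
  by apply: eq_bigr => i _; rewrite real_coord_frame_point// expr2.
by rewrite mulr_natl.
Qed.

Lemma measurable_gaussian_density sigma :
  measurable_fun setT (gaussian_density L sigma : borel_cover L -> R).
Proof.
apply: measurable_funM => //; apply: measurableT_comp => //.
apply: measurable_funN; apply: measurable_funM => //.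
rewrite (_ : (fun v => _) = fun v => ip L v v).
  exact: measurable_ip.
by apply/funext => v; exact: flat_normE.
Qed.

Local Open Scope ereal_scope.

(** In orthonormal coordinates the Gaussian measure is the product of
one-dimensional Gaussians. *)
Lemma gaussianE sigma (A : set (borel_cover L)) :
  sigma != 0%R -> measurable A ->
  gaussian sigma A =
  \int[leb (n + n)]_t ((\1_A (frame_point L t))%:E * (gweight sigma t)%:E).
Proof.
move=> s0 mA; rewrite /gaussian /volume lebE.
rewrite (ge0_integral_pushforward (measurable_frame_point L_ample))//; last 2 first.
- by apply/measurable_EFinP/measurable_funTS; exact: measurable_gaussian_density.
- by move=> v _; rewrite lee_fin gaussian_density_ge0.
rewrite integral_mkcond; apply: eq_integral => t _.
rewrite patchE indicE /= gaussian_density_frame_point//.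
rewrite -[t \in _]/(frame_point L t \in A).
by case: ifPn => _; rewrite ?mul1e ?mul0e.
Qed.

Lemma gaussian_total sigma : sigma != 0%R -> gaussian (L := L) sigma setT = 1.
Proof.
move=> s0; rewrite gaussianE//.
have h : (0 ^+ 2 = \sum_(i < n + n) (cst 0 i : R) ^+ 2)%R.
  by rewrite big1 ?expr0n// => i _; rewrite expr0n.
transitivity (\int[leb (n + n)]_t (cst 1 (tdot (cst 0%R) t) * (gweight sigma t)%:E)).
  by apply: eq_integral => t _; rewrite indicT.
rewrite (integral_gweight_proj s0 (lexx _) h)//.
under eq_integral do rewrite mul1e.
exact: integral_normal_pdf.
Qed.

Lemma gaussian_probability sigma : sigma != 0%R ->
  exists P : probability (borel_cover L) R, forall A, P A = gaussian sigma A.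
Proof.
move=> s0; have [vol volE] := volume_measure.
have [|P PE] := @probability_of_density _ _ R vol
    (gaussian_density L sigma : borel_cover L -> R) (measurable_gaussian_density _)
    (gaussian_density_ge0 _).
  by have := gaussian_total s0; rewrite /gaussian volE.
by exists P => A; rewrite PE /gaussian volE.
Qed.

Lemma measurable_indic_frame_point (A : set (borel_cover L)) : measurable A ->
  measurable_fun setT (fun t => (\1_A (frame_point L t))%:E : \bar R).
Proof.
move=> mA; apply/measurable_EFinP.
exact: (measurableT_comp (measurable_indic mA) (measurable_frame_point L_ample)).
Qed.

Lemma measurable_EFin_gweight sigma :
  measurable_fun setT (fun t => (@gweight R sigma (n + n) t)%:E).
Proof. by apply/measurable_EFinP; exact: measurable_gweight. Qed.

Lemma measurable_halfspace (a : V) (i : interval R) :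
  measurable [set v : borel_cover L | ip L a v \in i].
Proof.
have ma : measurable_fun setT (fun v : borel_cover L => ip L a v).
  by apply: (@measurable_ip _ _ _ _ _ (cst (a : borel_cover L)) id).
rewrite (_ : [set v | _] = (fun v : borel_cover L => ip L a v) @^-1` [set` i])//.
by rewrite -[X in measurable X]setTI; exact: ma.
Qed.

(** The linear form <a, -> is a Gaussian of standard deviation |a| sigma; open and
closed half-spaces have the same measure because a point of the line is
negligible. *)
Lemma gaussian_halfspace (side : bool) (sigma : R) (a : V) (l c : R) :
  sigma != 0%R -> (0 < l)%R -> (l ^+ 2 = ip L a a)%R ->
  gaussian sigma
    [set v : borel_cover L | ip L a v \in Interval (BSide side c) +oo%O] =
  \int[mu]_(x in `[(c / l)%R, +oo[) (normal_pdf 0 sigma x)%:E.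
Proof.
move=> s0 l0 lE; set i := Interval _ _.
rewrite gaussianE//; last exact: measurable_halfspace.
have h : (l ^+ 2 = \sum_i (real_coord L)^~ a i ^+ 2)%R.
  by rewrite lE ip_coords//; apply: eq_bigr => k _; rewrite expr2.
pose f (x : R) : \bar R := (\1_[set` i] x)%:E.
transitivity (\int[leb (n + n)]_t (f (tdot ((real_coord L)^~ a) t) * (gweight sigma t)%:E)).
  by apply: eq_integral => t _; rewrite /f !indicE -ip_frame_point.
rewrite (integral_gweight_proj s0 (ltW l0) h)//; last first.
- by move=> x; rewrite /f lee_fin indicE.
- by apply/measurable_EFinP; exact: measurable_indic.
transitivity (\int[mu]_(x in [set` Interval (BSide side (c / l)%R) +oo%O])
    (normal_pdf 0 sigma x)%:E).
  rewrite [RHS]integral_mkcond; apply: eq_integral => x _.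
  rewrite /f patchE indicE.
  have -> : ((l * x)%R \in [set` i]) =
      (x \in [set` Interval (BSide side (c / l)%R) +oo%O]).
    apply/idP/idP; rewrite !inE/= /i !in_itv/= !andbT;
    by case: side {i f}; rewrite /= ?ler_pdivrMr ?ltr_pdivrMr// mulrC.
  by case: ifPn => _; rewrite ?mul1e ?mul0e.
case: side @i f; first by [].
rewrite integral_itv_obnd_cbnd//; apply/measurable_EFinP/measurable_funTS.
exact: measurable_normal_pdf.
Qed.

(** Translating a set by - a increases its Gaussian measure when this brings each of
its points nearer to the origin: the density increases pointwise and the volume
is translation invariant. *)
Lemma gaussian_le_shift (sigma : R) (a : V) (E : set (borel_cover L)) : (0 < sigma)%R ->
  measurable E ->
  (forall v, E v -> ip L (v - a) (v - a) <= ip L v v)%R ->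
  gaussian sigma E <= gaussian sigma [set v : borel_cover L | E (v + a)%R].
Proof.
move=> s0 mE Ea; have sn0 : sigma != 0%R by rewrite gt_eqF.
have mEa : measurable [set v : borel_cover L | E (v + a)%R].
  rewrite -[X in measurable X]setTI.
  exact: (measurable_translation L_ample a).
rewrite !gaussianE//.
pose F t := (\1_E (frame_point L t))%:E *
  (gweight sigma (tshift (fun i => - (real_coord L i a))%R t))%:E : \bar R.
have mF : measurable_fun setT F.
  apply: emeasurable_funM; first exact: measurable_indic_frame_point.
  apply/measurable_EFinP.
  exact: (measurableT_comp (@measurable_gweight R sigma _) (measurable_tshift _)).
have F0 t : 0 <= F t by rewrite mule_ge0// lee_fin ?gweight_ge0// indicE.
apply: (@le_trans _ _ (\int[leb (n + n)]_t F t)).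
  apply: ge0_le_integral => //.
  - by move=> t _; rewrite mule_ge0// lee_fin ?gweight_ge0// indicE.
  - apply: emeasurable_funM; first exact: measurable_indic_frame_point.
    exact: measurable_EFin_gweight.
  - move=> t _; rewrite /F indicE.
    have [Et|_] := boolP (_ \in E); last by rewrite !mul0e.
    rewrite !mul1e lee_fin -!gaussian_density_frame_point//.
    have -> : frame_point L (tshift (fun i => - real_coord L i a)%R t) =
        (frame_point L t - a)%R.
      rewrite -frame_point_shift//; congr (frame_point L (tshift _ t)).
      by apply/funext => i; rewrite real_coordN.
    rewrite /gaussian_density ler_wpM2l//.
      by rewrite invr_ge0 exprn_ge0// mulr_ge0 ?sqr_ge0// mulr_ge0 ?pi_ge0.
    rewrite ler_expR lerN2 ler_pM2r; last by rewrite invr_gt0 mulr_gt0// exprn_gt0.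
    by rewrite !flat_normE//; apply: Ea; exact: set_mem.
rewrite -(integral_leb_shift ((real_coord L)^~ a) mF F0).
rewrite le_eqVlt; apply/orP; left; apply/eqP; apply: eq_integral => t _.
rewrite /F frame_point_shift//; congr ((\1_E _)%:E * (gweight _ _)%:E).
by apply: eq_from_tnth => i; rewrite !tnth_mktuple addrK.
Qed.

Lemma measurable_ball_compl c : measurable [set v : borel_cover L | (c <= ip L v v)%R].
Proof.
have ma : measurable_fun setT (fun v : borel_cover L => ip L v v).
  exact: measurable_ip.
rewrite (_ : [set v | _] = (fun v : borel_cover L => ip L v v) @^-1` `[c, +oo[).
  by rewrite -[X in measurable X]setTI; exact: ma.
by apply/seteqP; split => v /=; rewrite in_itv/= andbT.
Qed.

(** Chernoff bound: outside the ball of squared radius c, the density of variance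
sigma^2 is at most the stated constant times the density of the larger variance
(sigma / A)^2, whose total mass is 1. *)
Lemma gaussian_ball_compl (sigma A c : R) : (0 < sigma)%R -> (0 < A)%R ->
  (A <= 1)%R ->
  gaussian sigma [set v : borel_cover L | (c <= ip L v v)%R] <=
  ((A ^- (n + n)) * expR (- (c * (1 - A ^+ 2) / (2 * sigma ^+ 2))))%:E.
Proof.
move=> s0 A0 A1; have sn0 : sigma != 0%R by rewrite gt_eqF.
have An0 : A != 0%R by rewrite gt_eqF.
have sA0 : (sigma / A != 0)%R by rewrite mulf_neq0// invr_neq0.
rewrite gaussianE//; last exact: measurable_ball_compl.
set K := (_ * expR _)%R.
have K0 : (0 <= K)%R by rewrite mulr_ge0 ?expR_ge0// invr_ge0 exprn_ge0// ltW.
rewrite -[leRHS]mule1 -(@gaussian_total (sigma / A)%R)// gaussianE//.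
rewrite -ge0_integralZl//; last 2 first.
- apply: emeasurable_funM; first exact: measurable_indic_frame_point.
  exact: measurable_EFin_gweight.
- by move=> t _; rewrite mule_ge0// lee_fin ?gweight_ge0// indicE.
apply: ge0_le_integral => //.
- by move=> t _; rewrite mule_ge0// lee_fin ?gweight_ge0// indicE.
- apply: emeasurable_funM; last exact: measurable_EFin_gweight.
  by apply: measurable_indic_frame_point; exact: measurable_ball_compl.
- apply: emeasurable_funM => //.
  apply: emeasurable_funM; first exact: measurable_indic_frame_point.
  exact: measurable_EFin_gweight.
- move=> t _; rewrite indicT/= mul1e indicE.
  have [|_] := boolP (_ \in _); last first.
    by rewrite mul0e -EFinM lee_fin mulr_ge0// gweight_ge0.
  rewrite inE/= mul1e -EFinM lee_fin => ct.
  rewrite !gweightE// /K.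
  have -> : normal_peak (sigma / A) = (A * normal_peak sigma)%R.
    rewrite /normal_peak.
    rewrite (_ : (sigma / A) ^+ 2 * pi *+ 2 = (A^-1) ^+ 2 * (sigma ^+ 2 * pi *+ 2))%R; last by ring.
    by rewrite sqrtrM ?sqr_ge0// sqrtr_sqr gtr0_norm ?invr_gt0// invfM invrK.
  rewrite exprMn mulrACA (mulKf (expf_neq0 _ An0)) ler_wpM2l//.
    by rewrite exprn_ge0// normal_peak_ge0.
  rewrite -expRD ler_expR.
  have cE : (c <= \sum_i tnth t i ^+ 2)%R.
    apply: le_trans ct _; rewrite ip_coords// le_eqVlt; apply/orP; left; apply/eqP.
    by apply: eq_bigr => i _; rewrite real_coord_frame_point// expr2.
  set q := (\sum_i _)%R in cE *.
  rewrite -subr_ge0.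
  have -> : (- (c * (1 - A ^+ 2) / (2 * sigma ^+ 2)) +
      - q / ((sigma / A) ^+ 2 *+ 2) - - q / (sigma ^+ 2 *+ 2) =
      (q - c) * ((1 - A ^+ 2) / (2 * sigma ^+ 2)))%R.
    by field; rewrite An0 sn0.
  apply: mulr_ge0; first by rewrite subr_ge0.
  apply: divr_ge0; last by rewrite mulr_ge0// sqr_ge0.
  by rewrite subr_ge0 expr_le1// ltW.
Qed.

End GaussianFacts.

(** * The dual lattice and the polarization isogeny *)

Section RootsOfUnity.
Context {R : realType}.

(** The fractional part s of t satisfies cos(2 pi s) = 1, that is sin(pi s) = 0,
which excludes 0 < s < 1. *)
Lemma e2pi_eq1 (t : R) : e2pi t = 1 -> t \is a Num.int.
Proof.
move=> t1; rewrite -[t](subrK (Num.floor t)%:~R) rpredD ?intr_int//.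
set s := t - _.
have s0 : 0 <= s by rewrite subr_ge0 floor_le_tmp.
have s1 : s < 1 by rewrite ltrBlDr addrC; have := floorD1_gt t; rewrite intrD.
have : e2pi s = 1.
  by rewrite /s e2piD t1 mul1r e2pi_int// rpredN intr_int.
move: s0; rewrite le_eqVlt => /orP[/eqP <- _|s0 es]; first exact: rpred0.
have sp : 0 < sin (pi * s).
  by apply: sin_gt0_pi; rewrite mulr_gt0 ?pi_gt0//= gtr_pMr ?pi_gt0.
have /(congr1 (@complex.Re R)) := es.
rewrite /e2pi /= (_ : 2 * pi * s = (pi * s) *+ 2); last by ring.
rewrite cos_mulr2n cos2sin2 => h; have := exprn_gt0 2 sp; rewrite lt_neqAle => /andP[/negP[]].
by apply/eqP; lra.
Qed.

End RootsOfUnity.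

Section DualLattice.
Context {R : realType} {V : vectType R[i]} {Lam : zmodClosed V}.
Variable L : line_bundle Lam.
Hypothesis L_ample : ample L.
Local Notation n := (dim V).

(** The group Lam^#, which contains Lam with quotient K(L). *)
Definition dual_lattice (v : V) : Prop :=
  forall l, l \in Lam -> alt_form L v l \is a Num.int.

Lemma alt_formNl v w : alt_form L (- v) w = - alt_form L v w.
Proof. by rewrite /alt_form chern_formNl; case: (chern_form L v w). Qed.

Lemma dual_latticeN v : dual_lattice v -> dual_lattice (- v).
Proof. by move=> h l lL; rewrite alt_formNl rpredN; exact: h. Qed.

Lemma dual_latticeD v w : dual_lattice v -> dual_lattice w -> dual_lattice (v + w).
Proof. by move=> hv hw l lL; rewrite alt_formDl rpredD//; [exact: hv|exact: hw]. Qed.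

Lemma dual_latticeB v w : dual_lattice v -> dual_lattice w -> dual_lattice (v - w).
Proof. by move=> hv hw; apply: dual_latticeD => //; exact: dual_latticeN. Qed.

Lemma sub_dual_lattice v : v \in Lam -> dual_lattice v.
Proof. by move=> vL l lL; exact: chern_integral. Qed.

Lemma semichar_neq0 (M : line_bundle Lam) l : semichar M l != 0.
Proof. by rewrite -normr_eq0 semichar_norm oner_eq0. Qed.

Lemma Kgroup_cover v : Kgroup L (cover Lam v) <-> dual_lattice v.
Proof.
rewrite /Kgroup/= translate_cover; split=> [h l lL|h].
  have := congr1 (fun M => semichar M (exist _ l lL)) h => /= /eqP.
  rewrite -[X in _ == X]mulr1 (inj_eq (mulfI (semichar_neq0 _ _))) => /eqP.
  exact: e2pi_eq1.
apply: line_bundle_eq => //=; apply: funext => l.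
by rewrite e2pi_int ?mulr1//; apply: h; exact: valP.
Qed.

Lemma cover_eq0 v : cover Lam v = 0 <-> v \in Lam.
Proof.
have -> : 0 = cover Lam 0 by rewrite -[0 in RHS](subrr 0) coverB subrr.
by rewrite cover_eq subr0.
Qed.

(** In terms of semicharacters, the polarization isogeny sends the class of v to the
character exp(2 i pi E(v, -)) of Lam. *)
Lemma semichar_isogeny v l :
  semichar (sval (polarization_isogeny L (cover Lam v))) l = e2pi (alt_form L v (val l)).
Proof.
rewrite /polarization_isogeny [sval _]/= translate_cover/=.
by rewrite mulrAC mulfV ?mul1r// semichar_neq0.
Qed.

Lemma Pic0_eq (xi eta : Pic0 Lam) :
  (forall l, semichar (sval xi) l = semichar (sval eta) l) -> xi = eta.
Proof.
case: xi eta => [M M0] [M' M0'] /= h.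
have E : M = M' by apply: line_bundle_eq; [rewrite M0 M0'|exact: funext].
by subst M'; congr exist; exact: Prop_irrelevance.
Qed.

Lemma isogeny_eqP v w :
  polarization_isogeny L (cover Lam v) = polarization_isogeny L (cover Lam w) <->
  dual_lattice (v - w).
Proof.
split=> [h l lL|h].
  have e : e2pi (alt_form L v l) = e2pi (alt_form L w l).
    by rewrite -!(semichar_isogeny _ (exist _ l lL)) h.
  apply: e2pi_eq1; rewrite alt_formDl alt_formNl e2piD e -e2piV mulfV//.
  by rewrite -normr_eq0 norm_e2pi oner_eq0.
apply: Pic0_eq => l; rewrite !semichar_isogeny -[v](subrK w) alt_formDl e2piD.
by rewrite e2pi_int ?mul1r//; apply: h; exact: valP.
Qed.

Lemma real_coordZ i (c : R) v : real_coord L i (c%:C%C *: v) = c * real_coord L i v.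
Proof.
by rewrite /real_coord; case: fintype.split => j; rewrite chern_formZl;
  case: (chern_form L v _) => a d /=; ring.
Qed.

Lemma real_coord_inj v w : (forall i, real_coord L i v = real_coord L i w) -> v = w.
Proof.
move=> h; apply: (can_inj (real_coordsK L_ample)); apply: eq_from_tnth => i.
by rewrite !tnth_mktuple.
Qed.

Lemma real_coord0 i : real_coord L i 0 = 0.
Proof. by rewrite -(scale0r 0) -[0 in X in real_coord _ _ X]/(0%:C%C) real_coordZ mul0r. Qed.

Lemma real_coord_sum i (I : Type) (r : seq I) (f : I -> V) :
  real_coord L i (\sum_(k <- r) f k) = \sum_(k <- r) real_coord L i (f k).
Proof.
by apply: (big_morph (real_coord L i)) => [u v|]; [exact: real_coordD|exact: real_coord0].
Qed.

Lemma alt_formZl (c : R) v w : alt_form L (c%:C%C *: v) w = c * alt_form L v w.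
Proof. by rewrite /alt_form chern_formZl; case: (chern_form L v w) => a d /=; ring. Qed.

Lemma alt_formZr (c : R) v w : alt_form L v (c%:C%C *: w) = c * alt_form L v w.
Proof. by rewrite alt_formC alt_formZl alt_formC mulrN opprK. Qed.

Lemma alt_form0l w : alt_form L 0 w = 0.
Proof. by rewrite /alt_form chern_form0l. Qed.

Lemma alt_form_suml (I : Type) (r : seq I) (f : I -> V) w :
  alt_form L (\sum_(k <- r) f k) w = \sum_(k <- r) alt_form L (f k) w.
Proof.
by apply: (big_morph (alt_form L ^~ w)) => [u v|]; [exact: alt_formDl|exact: alt_form0l].
Qed.

Lemma alt_form_sumr (I : Type) (r : seq I) (f : I -> V) v :
  alt_form L v (\sum_(k <- r) f k) = \sum_(k <- r) alt_form L v (f k).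
Proof.
by rewrite alt_formC alt_form_suml -sumrN; apply: eq_bigr => k _; rewrite -alt_formC.
Qed.

(** E is the inner product twisted by the complex structure, which is an isometry
([ip_rotate]). *)
Lemma alt_form_ip v w : alt_form L v w = ip L (- 'i%C *: v) w.
Proof. by rewrite /alt_form /ip chern_formZl; case: (chern_form L v w) => a b /=; ring. Qed.

Lemma ip_rotate v : ip L (- 'i%C *: v) (- 'i%C *: v) = ip L v v.
Proof.
rewrite /ip chern_formZl chern_formC chern_formZl chern_formC.
by case: (chern_form L v v) => a b /=; ring.
Qed.

(** A weak form of the Cauchy-Schwarz inequality, enough to see that E(-, l) is
bounded on balls. *)
Lemma alt_form_bound v w : `|alt_form L v w| <= ip L v v + ip L w w.
Proof.
rewrite alt_form_ip -(ip_rotate v); set u := _ *: v.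
have := ip_ge0 L_ample (u - w); have := ip_ge0 L_ample (u + w).
rewrite ip_subb ipDl !ipDr (ipC L w u) ler_norml.
have := ip_ge0 L_ample u; have := ip_ge0 L_ample w.
by move=> *; apply/andP; split; lra.
Qed.

Variable b : 'I_(n + n) -> V.
Hypothesis b_free : forall c : 'I_(n + n) -> R,
  \sum_i (c i)%:C%C *: b i = 0 -> forall i, c i = 0.

(** The coordinates of the 2n vectors form a square matrix with independent rows. *)
Lemma lattice_basis_span v :
  exists c : 'I_(n + n) -> R, v = \sum_i (c i)%:C%C *: b i.
Proof.
pose B : 'M[R]_(n + n) := \matrix_(i, j) real_coord L j (b i).
have Bf : row_free B.
  rewrite -kermx_eq0; apply/rowV0P => u /sub_kermxP uB.
  apply/rowP => i; rewrite mxE; apply: (b_free (c := fun i => u 0 i)).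
  apply: real_coord_inj => j; rewrite real_coord_sum real_coord0.
  have := congr1 (fun M : 'rV_(n + n) => M 0 j) uB; rewrite !mxE => e; rewrite -[RHS]e.
  by apply: eq_bigr => k _; rewrite real_coordZ mxE.
have Bu : B \in unitmx by rewrite -row_free_unit.
pose c := (\row_j real_coord L j v) *m invmx B.
exists (fun i => c 0 i); apply: real_coord_inj => j; rewrite real_coord_sum.
have : c *m B = \row_j real_coord L j v by rewrite mulmxKV.
move/(congr1 (fun M : 'rV_(n + n) => M 0 j)); rewrite !mxE => e; rewrite -[LHS]e.
by apply: eq_bigr => k _; rewrite real_coordZ [B _ _]mxE.
Qed.

(** E(v, - i v) = |v|^2, and the b i span V over the reals. *)
Lemma alt_form_nondegenerate v : (forall i, alt_form L v (b i) = 0) -> v = 0.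
Proof.
move=> h; have [v0//|v0] := eqVneq v 0.
have [c cE] := lattice_basis_span (- 'i%C *: v).
have : alt_form L v (- 'i%C *: v) = 0.
  by rewrite cE alt_form_sumr big1// => i _; rewrite alt_formZr h mulr0.
by rewrite alt_form_ip ip_rotate => /eqP; rewrite gt_eqF// ip_gt0.
Qed.

(** The rows of N are the coordinates of the basis dual to b for the nondegenerate
form E.  An explicit linear formula is needed for measurability. *)
Lemma dual_basis : exists N : 'M[R]_(n + n), forall theta : 'I_(n + n) -> R,
  forall j, alt_form L
    (frame_point L [tuple \sum_k theta k * N k i | i < n + n]) (b j) = theta j.
Proof.
pose e (i : 'I_(n + n)) : V := frame_point L [tuple (i == j)%:R | j < n + n].
have eE (c : 'I_(n + n) -> R) : frame_point L [tuple c i | i < n + n] = \sum_i (c i)%:C%C *: e i.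
  rewrite /e; apply: real_coord_inj => j.
  rewrite [RHS]real_coord_sum real_coord_frame_point// tnth_mktuple.
  rewrite (bigD1 j)//= real_coordZ real_coord_frame_point// tnth_mktuple eqxx mulr1.
  rewrite big1 ?addr0// => k /negPf kj.
  by rewrite real_coordZ real_coord_frame_point// tnth_mktuple kj mulr0.
pose M : 'M[R]_(n + n) := \matrix_(i, j) alt_form L (e i) (b j).
have altE (c : 'I_(n + n) -> R) j : alt_form L (frame_point L [tuple c i | i < n + n]) (b j) =
    ((\row_i c i) *m M) 0 j.
  rewrite eE alt_form_suml mxE; apply: eq_bigr => i _.
  by rewrite alt_formZl !mxE.
have Mf : row_free M.
  rewrite -kermx_eq0; apply/rowV0P => u /sub_kermxP uM.
  have /(congr1 (real_coords L)) : frame_point L [tuple u 0 i | i < n + n] = 0.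
    apply: alt_form_nondegenerate => j; rewrite altE.
    rewrite (_ : \row_i _ = u) ?uM ?mxE//.
    by apply/rowP => i; rewrite mxE.
  rewrite frame_pointK// => h; apply/rowP => i.
  by have := congr1 (fun t => tnth t i) h; rewrite !tnth_mktuple real_coord0 mxE.
have Mu : M \in unitmx by rewrite -row_free_unit.
exists (invmx M) => theta j; rewrite altE.
rewrite (_ : \row_i _ = (\row_i theta i) *m invmx M).
  by rewrite mulmxKV// mxE.
by apply/rowP => i; rewrite !mxE; apply: eq_bigr => k _; rewrite mxE.
Qed.

End DualLattice.

(** * Parametrization of the dual lattice by integer vectors *)

Section LatticeParam.
Context {R : realType} {V : vectType R[i]} {Lam : zmodClosed V}.
Variable L : line_bundle Lam.
Hypothesis L_ample : ample L.
Local Notation n := (dim V).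
Variable b : 'I_(n + n) -> V.
Hypothesis b_free : forall c : 'I_(n + n) -> R,
  \sum_i (c i)%:C%C *: b i = 0 -> forall i, c i = 0.
Hypothesis b_span : forall v : V, v \in Lam <->
  exists k : 'I_(n + n) -> int, v = \sum_i b i *~ k i.
Variable N : 'M[R]_(n + n).

Definition dual_point (theta : 'I_(n + n) -> R) : V :=
  frame_point L [tuple \sum_k theta k * N k i | i < n + n].

Hypothesis NP : forall theta j, alt_form L (dual_point theta) (b j) = theta j.

Lemma lattice_basis_in j : b j \in Lam.
Proof.
apply/b_span; exists (fun i => (i == j)%:R).
rewrite (bigD1 j)//= eqxx big1 ?addr0// => i /negPf ->.
by rewrite mulr0z.
Qed.

Lemma alt_formMzr v w (k : int) : alt_form L v (w *~ k) = k%:~R * alt_form L v w.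
Proof. by rewrite -scaler_int -(rmorph_int (real_complex R)) alt_formZr. Qed.

Lemma dual_latticeP v : dual_lattice L v <->
  forall j, alt_form L v (b j) \is a Num.int.
Proof.
split=> [h j|h l /b_span[k ->]]; first by apply: h; exact: lattice_basis_in.
rewrite alt_form_sumr rpred_sum// => i _.
by rewrite alt_formMzr rpredM// intr_int.
Qed.

Lemma dual_pointK v : dual_point (fun j => alt_form L v (b j)) = v.
Proof.
apply/eqP; rewrite -subr_eq0; apply/eqP; apply: (alt_form_nondegenerate L_ample b_free) => i.
by rewrite alt_formDl alt_formNl NP subrr.
Qed.

(** A vector is determined by its values E(v, b j); on the dual lattice these are
integers, and they are bounded on a ball. *)
Lemma dual_ball_finite_of_basis (r : R) :
  finite_set [set v | dual_lattice L v /\ ip L v v <= r].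
Proof.
pose B := r + \sum_j ip L (b j) (b j).
have [K KB] : exists K : nat, B < K%:R.
  exists (Num.bound B); apply: le_lt_trans (ler_norm _) _.
  by have := archi_boundP (normr_ge0 B); rewrite /Num.bound normr_id.
pose g (k : {ffun 'I_(n + n) -> 'I_(K + K).+1}) :=
  dual_point (fun j => (k j : nat)%:R - K%:R).
apply: (@sub_finite_set _ _ (range g)); last by apply: finite_image; exact: finite_finset.
move=> v [/dual_latticeP dv vr].
have hz j : {z : int | alt_form L v (b j) = z%:~R}.
  by apply: cid; have /intrP[z ->] := dv j; exists z.
have zK j : `|sval (hz j)| <= K%:Z.
  rewrite -(ler_int R) intr_norm -(svalP (hz j)).
  apply: le_trans (alt_form_bound L_ample _ _) _; apply: le_trans (ltW KB).
  rewrite lerD// (bigD1 j)//= lerDl sumr_ge0// => i _.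
  exact: ip_ge0.
exists [ffun j => inord (absz (sval (hz j) + K%:Z))] => //.
rewrite /g -[RHS]dual_pointK; congr dual_point; apply/funext => j.
rewrite ffunE; transitivity ((sval (hz j))%:~R : R); last by rewrite -(svalP (hz j)).
move: (zK j); set z := sval (hz j); rewrite ler_norml => /andP[z1 z2].
have zK0 : 0 <= z + K%:Z by rewrite -lerBlDr sub0r.
have zKE : (absz (z + K%:Z))%:Z = z + K%:Z by rewrite gez0_abs.
rewrite inordK; last by rewrite ltnS -lez_nat zKE PoszD lerD2r.
have -> : (absz (z + K%:Z))%:R = (z + K%:Z)%:~R :> R by rewrite -[in RHS]zKE.
by rewrite intrD addrK.
Qed.

Lemma dual_lattice_enum_of_basis : exists kappa : nat -> V,
  (forall k, dual_lattice L (kappa k)) /\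
  (forall v, dual_lattice L v -> exists k, v = kappa k).
Proof.
exists (fun k => if (choice.unpickle k : option {ffun 'I_(n + n) -> int}) is Some z then
  dual_point (fun j => (z j)%:~R) else 0); split=> [k|v /dual_latticeP dv].
  case: choice.unpickle => [z|]; last by apply: sub_dual_lattice; exact: rpred0.
  by apply/dual_latticeP => j; rewrite NP intr_int.
have hz j : {z : int | alt_form L v (b j) = z%:~R}.
  by apply: cid; have /intrP[z ->] := dv j; exists z.
exists (choice.pickle [ffun j => sval (hz j)]); rewrite choice.pickleK -[LHS]dual_pointK.
by congr dual_point; apply/funext => j; rewrite ffunE; exact: svalP (hz j).
Qed.

(** Semicharacters with vanishing Chern form are characters, hence determined on a
basis of Lam. *)
Lemma semichar_ext (xi : Pic0 Lam) v :
  (forall j (l : {l : V | l \in Lam}), val l = b j ->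
    e2pi (alt_form L v (b j)) = semichar (sval xi) l) ->
  polarization_isogeny L (cover Lam v) = xi.
Proof.
move=> h; apply: Pic0_eq => -[l lL]; rewrite semichar_isogeny/=.
pose el (w : V) (p : w \in Lam) : {l : V | l \in Lam} := exist _ w p.
pose M := sval xi.
have MD (k l' m : {l : V | l \in Lam}) : val m = val k + val l' ->
    semichar M m = semichar M k * semichar M l'.
  move=> e; rewrite (semicharD M e) [chern_form M](svalP xi)/=.
  by rewrite mul0r e2pi0 mulr1.
pose Q w := exists p : w \in Lam, e2pi (alt_form L v w) = semichar M (el _ p).
have Q0 : Q 0.
  exists (rpred0 Lam); have -> : alt_form L v 0 = 0.
    by rewrite alt_formC alt_form0l oppr0.
  pose z : {l : V | l \in Lam} := exist _ 0 (rpred0 Lam).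
  rewrite e2pi0; apply: (mulfI (semichar_neq0 M z)).
  by rewrite mulr1 -(MD z z z)//= addr0.
have QD w w' : Q w -> Q w' -> Q (w + w').
  move=> [p pE] [p' pE']; exists (rpredD p p').
  by rewrite (MD (el _ p) (el _ p'))// alt_formDr e2piD pE pE'.
have QN w : Q w -> Q (- w).
  move=> [p pE]; have pN : - w \in Lam by rewrite rpredN.
  exists pN; have [p0 p0E] := Q0.
  apply: (mulfI (semichar_neq0 M (el _ p))).
  rewrite -(MD _ _ (el _ p0)) /= ?subrr// -p0E -pE -e2piD -alt_formDr subrr//.
have [k kE] : exists k : 'I_(n + n) -> int, l = \sum_i b i *~ k i by apply/b_span.
have [p ->] : Q l; last by congr semichar; congr exist; exact: bool_irrelevance.
rewrite kE; apply: (big_ind Q) => // i _.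
have Qb : Q (b i) by exists (lattice_basis_in i); apply: h.
have Qn (m : nat) : Q (b i *+ m).
  by elim: m => [|m IH]; rewrite ?mulr0n// mulrS; exact: QD.
by case: (k i) => m; [exact: Qn|rewrite NegzE mulrNz; exact/QN/Qn].
Qed.

End LatticeParam.

(** * A measurable lift of the dual torus to the cover *)

Section CircleArgument.
Context {R : realType}.

(** The arc cosine on [-1, 1], continued by constants, so that it is measurable on
the whole line. *)
Definition acos_ext (x : R) : R :=
  (acos \_ `](-1), 1[) x + pi * \1_(`]-oo, (-1)]) x.

Lemma acos_extE x : -1 <= x <= 1 -> acos_ext x = acos x.
Proof.
move=> /andP[x1 x2]; rewrite /acos_ext patchE indicE.
have [->|xn1] := eqVneq x (-1).
  rewrite ifN; last by rewrite mem_setE in_itv/= ltxx.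
  by rewrite mem_setE in_itv/= lexx mulr1 acosN1 add0r.
have -> : (x \in `]-oo, (-1)]%classic) = false.
  by rewrite mem_setE in_itv/= leNgt lt_neqAle eq_sym xn1 x1.
rewrite mulr0 addr0; have [->|xn2] := eqVneq x 1.
  by rewrite ifN ?acos1// mem_setE in_itv/= ltxx andbF.
by rewrite ifT// mem_setE in_itv/= !lt_neqAle x1 x2 eq_sym xn1 xn2.
Qed.

Lemma measurable_acos_ext : measurable_fun setT acos_ext.
Proof.
apply: measurable_funD.
  apply/(measurable_restrictT _ _).1 => //.
  apply: open_continuous_measurable_fun; first exact: interval_open.
  by move=> x; rewrite inE/= in_itv/= => ?; exact: continuous_acos.
by apply: measurable_funM => //; exact: measurable_indic.
Qed.

(** The argument, in units of a full turn. *)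
Definition circle_arg (z : R[i]) : R :=
  (if 0 <= complex.Im z then acos_ext (complex.Re z)
   else - acos_ext (complex.Re z)) / (2 * pi).

Lemma circle_argK z : `|z| = 1 -> e2pi (circle_arg z) = z.
Proof.
case: z => x y; rewrite normc_def/= => -[/(congr1 (fun t => t ^+ 2))].
have xy0 : 0 <= x ^+ 2 + y ^+ 2 by rewrite addr_ge0 ?sqr_ge0.
rewrite sqr_sqrtr// expr1n => xy.
have x1 : -1 <= x <= 1.
  have : x ^+ 2 <= 1 by rewrite -xy lerDl sqr_ge0.
  by move=> h; rewrite -ler_norml -(@expr_le1 _ 2)// real_normK// num_real.
have pi0 : pi != 0 :> R by rewrite gt_eqF// pi_gt0.
rewrite /e2pi /circle_arg /= acos_extE// mulrC divfK; last by rewrite mulf_neq0.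
have yE : Num.sqrt (1 - x ^+ 2) = `|y| by rewrite -xy addrC addKr sqrtr_sqr.
have [y0|y0] := leP 0 y.
  by rewrite acosK// sin_acos// yE ger0_norm.
by rewrite cosN sinN acosK// sin_acos// yE ltr0_norm// opprK.
Qed.

Context {d} {T : measurableType d}.

Lemma measurable_circle_arg (f : T -> R[i]) :
  measurable_fun setT (@complex.Re R \o f) -> measurable_fun setT (@complex.Im R \o f) ->
  measurable_fun setT (circle_arg \o f).
Proof.
move=> mr mi; apply: measurable_funM => //; apply: measurable_fun_ifT.
- exact: measurable_fun_ler.
- exact: (measurableT_comp measurable_acos_ext mr).
- by apply: measurable_funN; exact: (measurableT_comp measurable_acos_ext mr).
Qed.

End CircleArgument.

Section IsogenySection.
Context {R : realType} {V : vectType R[i]} {Lam : zmodClosed V}.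
Variable L : line_bundle Lam.
Hypothesis L_ample : ample L.
Hypothesis Lam_lattice : is_lattice Lam.
Local Notation n := (dim V).

Let dist_to (l : {l : V | l \in Lam}) (z : R[i]) (xi : borel_Pic0 (Lam := Lam)) : R :=
  complex.Re `|semichar (sval xi) l - z|.

Let measurable_dist_to l z : measurable_fun setT (dist_to l z).
Proof.
apply: (measurability _ (RGenInftyO.measurableE R)).
move=> _ [_ [c ->] <-]; rewrite setTI; apply: sub_sigma_algebra.
exists l, z, c; apply/seteqP; split => xi /=; by rewrite in_itv.
Qed.

Let ReE l xi : complex.Re (semichar (sval xi) l) = 1 - dist_to l 1 xi ^+ 2 / 2.
Proof.
rewrite /dist_to; have := semichar_norm (sval xi) l.
case: semichar => x y; rewrite !normc_def/= => -[/(congr1 (fun t => t ^+ 2))].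
by rewrite !sqr_sqrtr ?addr_ge0 ?sqr_ge0// expr1n oppr0 addr0 => h; nra.
Qed.

Let ImE l xi : complex.Im (semichar (sval xi) l) = 1 - dist_to l 'i%C xi ^+ 2 / 2.
Proof.
rewrite /dist_to; have := semichar_norm (sval xi) l.
case: semichar => x y; rewrite !normc_def/= => -[/(congr1 (fun t => t ^+ 2))].
by rewrite !sqr_sqrtr ?addr_ge0 ?sqr_ge0// expr1n oppr0 addr0 => h; nra.
Qed.

(** The sigma-algebra of Pic^0 makes the distances |chi(l) - z| measurable, and on
the unit circle the real and imaginary parts are polynomials in the distances to
1 and i. *)
Lemma measurable_semichar_arg l :
  measurable_fun setT (fun xi : borel_Pic0 (Lam := Lam) => circle_arg (semichar (sval xi) l)).
Proof.
apply: (@measurable_circle_arg _ _ _ (fun xi : borel_Pic0 => semichar (sval xi) l)).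
  rewrite (_ : _ \o _ = fun xi => 1 - dist_to l 1 xi ^+ 2 / 2); last first.
    by apply/funext => xi /=; exact: ReE.
  apply: measurable_funB => //; apply: measurable_funM => //.
  exact: measurable_funX.
rewrite (_ : _ \o _ = fun xi => 1 - dist_to l 'i%C xi ^+ 2 / 2); last first.
  by apply/funext => xi /=; exact: ImE.
apply: measurable_funB => //; apply: measurable_funM => //.
exact: measurable_funX.
Qed.

(** Measure the arguments theta j of the character on the basis b of Lam, and take
the v with E(v, b j) = theta j. *)
Lemma isogeny_section : exists tau : borel_Pic0 (Lam := Lam) -> borel_cover L,
  measurable_fun setT tau /\
  forall xi, polarization_isogeny L (cover Lam (tau xi)) = xi.
Proof.
have [b [b_free b_span]] := Lam_lattice.
have [N NP] := dual_basis L_ample b_free.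
pose bl j : {l : V | l \in Lam} := exist _ (b j) (lattice_basis_in b_span j).
pose th (xi : borel_Pic0 (Lam := Lam)) j := circle_arg (semichar (sval xi) (bl j)).
exists (fun xi => dual_point L N (th xi)); split.
  apply: (measurableT_comp (measurable_frame_point L_ample)).
  apply/measurable_fun_tnthP => i.
  rewrite (_ : _ \o _ = fun xi => \sum_k th xi k * N k i); last first.
    by apply/funext => xi /=; rewrite tnth_mktuple.
  apply: measurable_sum => k; apply: measurable_funM => //.
  exact: measurable_semichar_arg.
move=> xi; apply: (semichar_ext b_span) => j l lE.
rewrite (NP (th xi)) circle_argK ?semichar_norm//.
by congr semichar; exact: val_inj.
Qed.

Lemma dual_ball_finite (r : R) :
  finite_set [set v | dual_lattice L v /\ ip L v v <= r].
Proof.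
have [b [b_free b_span]] := Lam_lattice.
have [N NP] := dual_basis L_ample b_free.
exact: (dual_ball_finite_of_basis L_ample b_free b_span NP).
Qed.

Lemma dual_lattice_enum : exists kappa : nat -> V,
  (forall k, dual_lattice L (kappa k)) /\
  (forall v, dual_lattice L v -> exists k, v = kappa k).
Proof.
have [b [b_free b_span]] := Lam_lattice.
have [N NP] := dual_basis L_ample b_free.
exact: (dual_lattice_enum_of_basis L_ample b_free b_span NP).
Qed.

End IsogenySection.

(** * Shortest vectors of the dual lattice outside the lattice *)

Lemma finite_argmin (R : realType) (T : choiceType) (A : set T) (f : T -> R) :
  finite_set A -> A !=set0 -> exists2 x, A x & forall y, A y -> f x <= f y.
Proof.
move=> /finite_seqP[s ->]; elim: s => [[x]//|a s IH] _.
have [s0|s0] := eqVneq s [::].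
  by exists a; rewrite ?s0 /= ?mem_head// => y; rewrite /= inE => /eqP ->.
have [|x xs xm] := IH.
  by case: s s0 {IH} => // c s _; exists c; rewrite /= mem_head.
have [ax|xa] := leP (f a) (f x).
  exists a => [|y]; rewrite /= ?mem_head// inE => /orP[/eqP ->//|/xm].
  exact: le_trans.
exists x => [|y]; rewrite /= inE ?[x \in s]xs ?orbT// => /orP[/eqP ->|/xm//].
exact: ltW.
Qed.

Lemma inf_attained (R : realType) (A : set R) (x : R) : A x -> (forall y, A y -> x <= y) -> inf A = x.
Proof.
move=> Ax xm; apply/le_anti/andP; split.
  by apply: ge_inf => //; exists x => y; exact: xm.
by apply: lb_le_inf; [exists x|move=> y; exact: xm].
Qed.

Section ShortestVectors.
Context {R : realType} {V : vectType R[i]} {Lam : zmodClosed V}.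
Variable L : line_bundle Lam.
Hypothesis L_ample : ample L.
Hypothesis Lam_lattice : is_lattice Lam.

(** The displacements that act on the torus as a nonzero element of K(L).  They do
not change the image under the isogeny, so no decoder can detect them. *)
Definition logical (v : V) : Prop := dual_lattice L v /\ v \notin Lam.

Lemma logicalP v : Kgroup L (cover Lam v) /\ cover Lam v != 0 <-> logical v.
Proof.
split=> [[/Kgroup_cover dv v0]|[dv v0]]; split=> //.
- by apply: contraNN v0 => /cover_eq0 ->.
- exact/Kgroup_cover.
- by apply: contraNneq v0 => /cover_eq0.
Qed.

Lemma logicalN v : logical v -> logical (- v).
Proof. by move=> [dv v0]; split; [exact: dual_latticeN|rewrite rpredN]. Qed.

Lemma logical_neq0 v : logical v -> v != 0.
Proof. by move=> [_]; apply: contraNneq => ->; exact: rpred0. Qed.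

Lemma flat_norm_ge0 v : 0 <= flat_norm L v.
Proof. exact: sqrtr_ge0. Qed.

Lemma flat_norm_le v w : (flat_norm L v <= flat_norm L w) = (ip L v v <= ip L w w).
Proof. by rewrite -!flat_normE// ler_pXn2r// nnegrE flat_norm_ge0. Qed.

(** Balls of the dual lattice are finite, so minimal lengths are attained. *)
Lemma dual_lattice_argmin (P : set V) : P !=set0 -> P `<=` dual_lattice L ->
  exists2 v, P v & forall w, P w -> flat_norm L v <= flat_norm L w.
Proof.
move=> [v Pv] PL.
pose A := [set w | P w /\ ip L w w <= ip L v v].
have finA : finite_set A.
  apply: sub_finite_set (dual_ball_finite L_ample Lam_lattice (ip L v v)).
  by move=> w [/PL dw wv].
have [|w [Pw wv] wm] := @finite_argmin _ _ A (flat_norm L) finA.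
  by exists v; split.
exists w => // u Pu; have [uv|vu] := leP (ip L u u) (ip L v v); first exact: wm.
by rewrite flat_norm_le (le_trans wv)// ltW.
Qed.

Lemma logical_argmin (P : set V) : P !=set0 -> P `<=` logical ->
  exists2 v, P v & forall w, P w -> flat_norm L v <= flat_norm L w.
Proof. by move=> P0 PL; apply: dual_lattice_argmin => // v /PL[]. Qed.

Lemma dual_lattice_separated : exists2 m0, 0 < m0 &
  forall v, dual_lattice L v -> ip L v v < m0 -> v = 0.
Proof.
pose P := [set v | dual_lattice L v /\ v != 0].
have [P0|P0] := pselect (P !=set0); last first.
  exists 1 => // v dv _; apply: contrapT => /eqP v0.
  by apply: P0; exists v.
have [w [dw w0] wm] : exists2 w, P w & forall v, P v -> flat_norm L w <= flat_norm L v.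
  by apply: dual_lattice_argmin => // v [].
exists (ip L w w); first exact: ip_gt0.
move=> v dv h; apply: contrapT => /eqP v0.
have := wm v (conj dv v0); rewrite flat_norm_le => /le_lt_trans/(_ h).
by rewrite ltxx.
Qed.

Hypothesis K_nontrivial : exists2 x : torus Lam, Kgroup L x & x != 0.

Let logical_nonempty : logical !=set0.
Proof.
by have [x Kx x0] := K_nontrivial; exists (Defs.lift x); apply/logicalP; rewrite Defs.liftK.
Qed.

Lemma ell_min : exists2 v, logical v & flat_norm L v = ell L.
Proof.
have [v lv vm] := logical_argmin logical_nonempty (@subset_refl _ _).
exists v => //; rewrite /ell; apply/esym/inf_attained.
  by exists v => //; exact/logicalP.
by move=> _ [w /logicalP lw <-]; exact: vm.
Qed.

Lemma ell_le v : logical v -> ell L <= flat_norm L v.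
Proof.
move=> lv; apply: ge_inf; last by exists v => //; exact/logicalP.
by exists 0 => _ [w _ <-]; exact: flat_norm_ge0.
Qed.

Lemma ell_gt0 : 0 < ell L.
Proof.
have [v lv <-] := ell_min; rewrite lt_neqAle flat_norm_ge0 andbT eq_sym.
by rewrite -sqrf_eq0 flat_normE// gt_eqF// ip_gt0// logical_neq0.
Qed.

(** Lengths of logical vectors do not accumulate at [ell L]. *)
Lemma ell_gap : exists2 delta, 0 < delta &
  forall v, logical v -> ip L v v < ell L ^+ 2 + delta -> flat_norm L v = ell L.
Proof.
pose P := [set v | logical v /\ flat_norm L v != ell L].
have [P0|P0] := pselect (P !=set0); last first.
  exists 1 => // v lv _; apply: contrapT => /eqP vl.
  by apply: P0; exists v.
have PL : P `<=` logical by move=> v [].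
have [w [lw wl] wm] := logical_argmin P0 PL.
exists (ip L w w - ell L ^+ 2).
  rewrite subr_gt0 -flat_normE// ltr_pXn2r ?nnegrE ?flat_norm_ge0 ?ltW ?ell_gt0//.
  by rewrite lt_neqAle eq_sym wl ell_le.
move=> v lv; rewrite addrC subrK => h; apply: contrapT => /eqP vl.
have := wm v (conj lv vl); rewrite flat_norm_le => /le_lt_trans/(_ h).
by rewrite ltxx.
Qed.

Definition shortest : set V := [set v | logical v /\ flat_norm L v = ell L].

Lemma shortest_finite : finite_set shortest.
Proof.
apply: sub_finite_set (dual_ball_finite L_ample Lam_lattice (ell L ^+ 2)).
by move=> v [[dv _] vl]; split => //; rewrite -flat_normE// vl.
Qed.

Lemma ip_shortest v : shortest v -> ip L v v = ell L ^+ 2.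
Proof. by move=> [_ vl]; rewrite -flat_normE// vl. Qed.

(** The distance of a point of K(L) to the origin is attained by one of its lifts,
which is a logical vector. *)
Lemma nearest_pointsE : nearest_points L = cover Lam @` shortest.
Proof.
apply/seteqP; split => [x [Kx x0 dx]|_ [v [lv vl] <-]].
  pose P := geodesics_to (Lam := Lam) x.
  have P0 : P !=set0 by exists (Defs.lift x); exact: Defs.liftK.
  have PL : P `<=` logical.
    by move=> v /= vx; apply/logicalP; rewrite vx.
  have [v Pv vm] := logical_argmin P0 PL.
  exists v; last exact: Pv.
  split; first exact: PL.
  rewrite -dx; apply/esym/inf_attained; first by exists v.
  by move=> _ [w Pw <-]; exact: vm.
have [Kv v0] := (logicalP v).2 lv; split => //.
rewrite /dist0 -vl; apply: inf_attained; first by exists v.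
move=> _ [w wv <-]; rewrite vl; apply: ell_le.
by apply/logicalP; rewrite wv.
Qed.

(** The shortest geodesics to one of the nearest points of K(L) form a fibre of the
projection restricted to the shortest logical vectors. *)
Lemma nb_nearestE : nb_nearest L = #|` fset_set shortest|.
Proof.
have fS := shortest_finite.
rewrite /nb_nearest nearest_pointsE (fset_set_image _ fS).
rewrite [RHS]card_fset_sum1 (partition_big_imfset _ (cover Lam))/=.
rewrite [LHS]big_seq [RHS]big_seq; apply: eq_bigr => x xS.
rewrite [RHS]big_fset_condE -card_fset_sum1 /nb_shortest_geodesics.
have Kx : Kgroup L x /\ x != 0.
  have /imfsetP[/= v + ->] := xS; rewrite in_fset_set// inE => -[lv _].
  exact/logicalP.
have E : [set v | geodesics_to x v /\ flat_norm L v = ell L] =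
    shortest `&` [set v | cover Lam v = x].
  apply/seteqP; split => [v [vx vl]|v [[_ vl] vx]]; split => //; split => //.
  by apply/logicalP; rewrite vx.
congr size; congr enum_fset; apply/fsetP => v.
rewrite in_fset_set; last by rewrite E; exact: finite_setIl.
rewrite !inE/= in_fset_set// E in_setI; congr (_ && _).
by apply/idP/eqP; rewrite inE.
Qed.

Lemma nb_nearest_gt0 : (0 < nb_nearest L)%N.
Proof.
rewrite nb_nearestE cardfs_gt0; have [v lv vl] := ell_min.
apply/fset0Pn; exists v; rewrite in_fset_set; last exact: shortest_finite.
by rewrite inE.
Qed.

End ShortestVectors.

(** * Every decoder misses the caps *)

Section Converse.
Context {R : realType} {V : vectType R[i]} {Lam : zmodClosed V}.
Variable L : line_bundle Lam.
Hypothesis L_ample : ample L.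
Hypothesis Lam_lattice : is_lattice Lam.
Hypothesis K_nontrivial : exists2 x : torus Lam, Kgroup L x & x != 0.

Import HBNNSimple.

(** The integral over an arbitrary set is a supremum over simple functions, and the
support of such a function is a measurable subset.  This makes the image of a
decoder tractable without proving that it is a Borel set. *)
Lemma gaussian_inner_regular sigma (A : set (borel_cover L)) (c : \bar R) :
  (forall S, measurable S -> S `<=` A -> (gaussian sigma S <= c)%E) ->
  (gaussian sigma A <= c)%E.
Proof.
move=> h; have [vol volE] := volume_measure L_ample.
rewrite /gaussian volE ge0_integralE; last first.
  by move=> v _; rewrite lee_fin gaussian_density_ge0.
apply: ge_ereal_sup => _ [f /= fA <-].
pose S : set (borel_cover L) := [set v | f v != 0].
have mS : measurable S.
  rewrite (_ : S = ~` (f @^-1` [set 0])); last first.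
    by apply/seteqP; split=> v /= /eqP.
  by apply: measurableC; rewrite -[X in measurable X]setTI; exact: (measurable_funP f).
have SA : S `<=` A.
  move=> v /= fv; apply: contrapT => nAv; have := fA v.
  rewrite patchE memNset// lee_fin => f0.
  by move/eqP: fv; apply; apply/eqP; rewrite eq_le f0/= fun_ge0.
apply: le_trans (h S mS SA).
have := @integral_nnsfun _ _ R vol setT measurableT f.
rewrite patch_setT => <-.
rewrite /gaussian volE [leRHS]integral_mkcond; apply: ge0_le_integral => //.
- by move=> v _; rewrite lee_fin fun_ge0.
- by apply/measurable_EFinP; exact: (measurable_funP f).
- have mg : measurable_fun S (fun v : borel_cover L => (gaussian_density L sigma v)%:E).
    by apply/measurable_EFinP/measurable_funTS; exact: measurable_gaussian_density.
  exact: (measurable_restrictT _ mS).1 mg.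
- move=> v _; rewrite patchE; case: ifPn => vS.
    by have := fA v; rewrite patchE mem_set//; apply: SA; exact: set_mem.
  have -> : f v = 0 by apply/eqP; apply: contraNT vS => fv; exact: mem_set.
  by [].
Qed.

(** A section of the isogeny meets each coset of its kernel at most once. *)
Lemma decoder_range_inj (D : borel_Pic0 -> borel_torus L) v w :
  decoder D -> range D (cover Lam v) -> range D (cover Lam w) ->
  dual_lattice L (v - w) -> v - w \in Lam.
Proof.
move=> [_ DK] [xi _ Dxi] [eta _ Deta] /isogeny_eqP.
by rewrite -Dxi -Deta !DK => e; apply/cover_eq; rewrite -Dxi -Deta e.
Qed.

(** The Gaussian mass of a half-space at distance [ell L / 2] from the origin. *)
Definition half_tail (sigma : R) : R :=
  fine (\int[lebesgue_measure]_(x in `[(ell L / 2)%R, +oo[)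
          (normal_pdf 0 sigma x)%:E)%E.

Section OneSigma.
Variable sigma : R.
Hypothesis sigma0 : 0 < sigma.
Variable r2 : R.
Hypothesis r2_sep : forall v, dual_lattice L v -> ip L v v < 16 * r2 -> v = 0.

Let sn0 : sigma != 0. Proof. by rewrite gt_eqF. Qed.
Let c2 : R := ell L ^+ 2 / 4 + r2.

Definition far : set (borel_cover L) := [set v | c2 <= ip L v v].

(** The half-space of the points nearer to mu than to 0, cut by the ball of
squared radius |mu|^2 / 4 + r2: it is contained in the ball of centre mu / 2 and
squared radius r2 ([outer_cap_center]). *)
Definition outer_cap (mu : V) : set (borel_cover L) :=
  [set v | ell L ^+ 2 / 2 < ip L mu v /\ ip L v v < c2].

(** The outer cap translated by - mu, which lies near - mu / 2. *)
Definition inner_cap (mu : V) : set (borel_cover L) :=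
  [set v | outer_cap mu (v + mu)].

Let q := half_tail sigma.
Let t := fine (gaussian sigma far).

Lemma gaussian_fin_num (A : set (borel_cover L)) :
  measurable A -> gaussian sigma A \is a fin_num.
Proof.
by move=> mA; have [P PE] := gaussian_probability L_ample sn0; rewrite -PE fin_num_measure.
Qed.

Lemma far_measurable : measurable far.
Proof. exact: measurable_ball_compl. Qed.

Lemma gaussian_farE : gaussian sigma far = t%:E.
Proof.
by rewrite fineK// gaussian_fin_num//; exact: far_measurable.
Qed.

Let ell_div : ell L ^+ 2 / 2 / ell L = ell L / 2.
Proof. by field; rewrite gt_eqF// ell_gt0. Qed.

Lemma gaussian_half side mu : shortest L mu ->
  gaussian sigma
    [set v : borel_cover L | ip L mu v \in Interval (BSide side (ell L ^+ 2 / 2)) +oo%O]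
  = q%:E.
Proof.
move=> smu; have l0 := ell_gt0 L_ample Lam_lattice K_nontrivial.
have E := gaussian_halfspace L_ample side (ell L ^+ 2 / 2) sn0 l0 (esym (ip_shortest L_ample smu)).
rewrite E ell_div /q /half_tail fineK//; rewrite -ell_div -E.
by apply: gaussian_fin_num; exact: measurable_halfspace.
Qed.

Lemma outer_cap_measurable mu : measurable (outer_cap mu).
Proof.
rewrite (_ : outer_cap mu =
    [set v : borel_cover L | ip L mu v \in `](ell L ^+ 2 / 2), +oo[] `&` ~` far).
  apply: measurableI; first exact: measurable_halfspace.
  by apply: measurableC; exact: far_measurable.
apply/seteqP; split => v /=; rewrite in_itv/= andbT.
  by move=> [h1 h2]; split => //; rewrite /far/= ; apply/negP; rewrite -ltNge.
by move=> [h1 /negP]; rewrite -ltNge.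
Qed.

Lemma inner_cap_measurable mu : measurable (inner_cap mu).
Proof.
rewrite -[X in measurable X]setTI.
exact: (measurable_translation L_ample mu _ (outer_cap_measurable mu)).
Qed.

(** A half-space is covered by the cap and the complement of the ball. *)
Lemma gaussian_outer_cap mu : shortest L mu ->
  ((q - t)%:E <= gaussian sigma (outer_cap mu))%E.
Proof.
move=> smu; have [P PE] := gaussian_probability L_ample sn0.
rewrite EFinB leeBlDr// -gaussian_farE -(gaussian_half false smu) -!PE.
apply: le_trans (measureU2 _ (outer_cap_measurable mu) far_measurable).
apply: le_measure; rewrite ?inE.
- exact: measurable_halfspace.
- exact: measurableU (outer_cap_measurable mu) far_measurable.
- move=> v /=; rewrite in_itv/= andbT => h.
  have [f|nf] := leP c2 (ip L v v); first by right.
  by left.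
Qed.

Lemma outer_capB mu v : shortest L mu -> outer_cap mu v ->
  ip L (v - mu) (v - mu) <= ip L v v.
Proof. by move=> smu [h _]; rewrite ip_subb (ip_shortest L_ample smu) ipC; lra. Qed.

Lemma outer_cap_center mu v : shortest L mu -> outer_cap mu v ->
  ip L (v + v - mu) (v + v - mu) < 4 * r2.
Proof.
move=> smu [h1 h2]; rewrite ip_subb !ipDl !ipDr (ip_shortest L_ample smu).
by move: h1 h2; rewrite (ipC L v mu) /c2; lra.
Qed.

Lemma inner_cap_center mu v : shortest L mu -> inner_cap mu v ->
  ip L (v + v + mu) (v + v + mu) < 4 * r2.
Proof.
move=> smu /(outer_cap_center smu).
by rewrite (_ : v + mu + (v + mu) - mu = v + v + mu)// addrACA addrA addrK.
Qed.

(** If v is within distance 2 sqrt(r2) of both w1 and w2, then |w1 - w2|^2 < 16 r2. *)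
Lemma caps_center_inj v w1 w2 : dual_lattice L w1 -> dual_lattice L w2 ->
  ip L (v - w1) (v - w1) < 4 * r2 -> ip L (v - w2) (v - w2) < 4 * r2 -> w1 = w2.
Proof.
move=> d1 d2 h1 h2; apply/eqP; rewrite -subr_eq0; apply/eqP; apply: r2_sep.
  exact: dual_latticeB.
rewrite (_ : w1 - w2 = (v - w2) - (v - w1)); last by rewrite opprB [RHS]addrC subrKA.
move: h1 h2; move: (v - w2) (v - w1) => a b h1 h2.
have := ip_ge0 L_ample (a + b); rewrite ip_subb ipDl !ipDr (ipC L b a).
by move: h1 h2; lra.
Qed.

(** The two caps can meet only if they have the same centre, that is mu = - nu; they
are then on opposite sides of the hyperplane <mu, v> = |mu|^2 / 2. *)
Lemma outer_inner_disjoint mu nu v : shortest L mu -> shortest L nu ->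
  outer_cap mu v -> inner_cap nu v -> False.
Proof.
move=> smu snu ov iv.
have mE : mu = - nu.
  apply: (@caps_center_inj (v + v)); [exact: smu.1.1| |exact: outer_cap_center|].
    by apply: dual_latticeN; exact: snu.1.1.
  by rewrite opprK; exact: inner_cap_center.
case: ov iv => h _ [+ _]; rewrite ipDr (ip_shortest L_ample snu).
by move: h; rewrite mE ipNl; lra.
Qed.

Definition caps mu : set (borel_cover L) := outer_cap mu `|` inner_cap mu.

Variable S : set (borel_cover L).
Hypothesis mS : measurable S.
Hypothesis S_shift : forall v mu, logical L mu -> S v -> ~ S (v - mu).

(** For v in the outer cap, v or v - mu is outside S.  The set of the v for which
v - mu is outside S gains mass when translated by - mu into the inner cap. *)
Lemma gaussian_outer_cap_le mu : shortest L mu ->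
  (gaussian sigma (outer_cap mu) <= gaussian sigma (~` S `&` caps mu))%E.
Proof.
move=> smu; have [P PE] := gaussian_probability L_ample sn0.
pose E := [set v : borel_cover L | outer_cap mu v /\ ~ S (v - mu)].
have mE : measurable E.
  apply: measurableI; first exact: outer_cap_measurable.
  rewrite -[X in measurable X]setTI.
  exact: (measurable_translation L_ample (- mu) _ (measurableC mS)).
have mo := outer_cap_measurable mu; have mi := inner_cap_measurable mu.
have mCS := measurableC mS.
apply: (@le_trans _ _ (gaussian sigma (~` S `&` outer_cap mu) + gaussian sigma E)%E).
  rewrite -!PE.
  apply: le_trans (measureU2 _ _ mE); last exact: measurableI.
  apply: le_measure; rewrite ?inE//.
    by apply: measurableU => //; exact: measurableI.
  move=> v ov; have [Sv|nSv] := pselect (S v); last by left.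
  by right; split => //; apply: S_shift => //; exact: smu.1.
apply: (@le_trans _ _ (gaussian sigma (~` S `&` outer_cap mu) +
    gaussian sigma (~` S `&` inner_cap mu))%E).
  rewrite leeD2l//.
  have -> : ~` S `&` inner_cap mu = [set v : borel_cover L | E (v + mu)].
    apply/seteqP; split => v /=; rewrite /E/= addrK; by case.
  by apply: gaussian_le_shift => // v [ov _]; exact: outer_capB.
rewrite -!PE -measureU//.
- by rewrite /caps setIUr.
- exact: measurableI.
- exact: measurableI.
- apply/seteqP; split => // v [[_ ov] [_ iv]].
  exact: (outer_inner_disjoint smu smu ov iv).
Qed.

Lemma caps_disjoint : trivIset (shortest L) (fun mu => ~` S `&` caps mu).
Proof.
move=> mu nu smu snu [v [[_ [ov|iv]] [_ [ov'|iv']]]].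
- apply: (@caps_center_inj (v + v)); [exact: smu.1.1|exact: snu.1.1| |];
  exact: outer_cap_center.
- by have := outer_inner_disjoint smu snu ov iv'.
- by have := outer_inner_disjoint snu smu ov' iv.
- apply: oppr_inj; apply: (@caps_center_inj (v + v)).
  + by apply: dual_latticeN; exact: smu.1.1.
  + by apply: dual_latticeN; exact: snu.1.1.
  + by rewrite opprK; exact: inner_cap_center.
  + by rewrite opprK; exact: inner_cap_center.
Qed.

Lemma sum_shortest (c : R) :
  (\sum_(mu \in shortest L) c%:E)%E = ((nb_nearest L)%:R * c)%:E.
Proof.
rewrite fsbig_finite; last exact: shortest_finite.
rewrite sumEFin big_const_seq count_predT iter_addr_0.
by rewrite nb_nearestE// mulr_natl.
Qed.

(** The disjoint sets of [caps_disjoint] all contribute to the complement of S. *)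
Lemma gaussian_converse :
  (gaussian sigma S <= (1 - (nb_nearest L)%:R * (q - t))%:E)%E.
Proof.
have [P PE] := gaussian_probability L_ample sn0.
have mC mu : measurable (~` S `&` caps mu).
  apply: measurableI; first exact: measurableC.
  apply: measurableU; [exact: outer_cap_measurable|exact: inner_cap_measurable].
have fS := shortest_finite L_ample Lam_lattice.
rewrite -PE -[S]setCK probability_setC; last exact: measurableC.
rewrite EFinB leeB// -sum_shortest.
apply: (@le_trans _ _ (\sum_(mu \in shortest L) P (~` S `&` caps mu))%E).
  apply: lee_fsum => // mu smu; apply: le_trans (gaussian_outer_cap smu) _.
  by rewrite PE; exact: gaussian_outer_cap_le.
rewrite -measure_fin_bigcup//; last exact: caps_disjoint.
apply: le_measure; rewrite ?inE.
- exact: fin_bigcup_measurable.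
- exact: measurableC.
- by move=> v [mu _ []].
Qed.

End OneSigma.
End Converse.

(** * A decoder covering the open cell around the origin *)

Section Achievability.
Context {R : realType} {V : vectType R[i]} {Lam : zmodClosed V}.
Variable L : line_bundle Lam.
Hypothesis L_ample : ample L.
Hypothesis Lam_lattice : is_lattice Lam.
Hypothesis K_nontrivial : exists2 x : torus Lam, Kgroup L x & x != 0.

(** Vectors of Lam are no competitors of 0: the cell contains the Voronoi cell of 0
in Lam^#, and may be larger. *)
Definition voronoi : set (borel_cover L) :=
  [set v | forall mu, logical L mu -> ip L v v < ip L (v - mu) (v - mu)].

Lemma voronoi_ipP v mu :
  ip L v v < ip L (v - mu) (v - mu) <-> ip L mu v < ip L mu mu / 2.
Proof. by rewrite ip_subb (ipC L mu v); split; lra. Qed.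

Lemma voronoi_measurable : measurable voronoi.
Proof.
have [kappa [kd kE]] := dual_lattice_enum L_ample Lam_lattice.
pose F k := [set v : borel_cover L |
  ip L (kappa k) v \in `[(ip L (kappa k) (kappa k) / 2), +oo[].
rewrite (_ : voronoi = ~` \bigcup_(k in [set k | logical L (kappa k)]) F k).
  apply/measurableC/bigcup_measurable => k _; exact: measurable_halfspace.
apply/seteqP; split => v /=.
  move=> vv [k lk]; rewrite /F/= in_itv/= andbT leNgt => /negP; apply.
  by apply/voronoi_ipP/vv.
move=> nv mu lmu; apply/voronoi_ipP; rewrite ltNge; apply/negP => h.
have [k kmu] := kE mu lmu.1; apply: nv; exists k; first by rewrite /= -kmu.
by rewrite /F/= in_itv/= andbT -kmu.
Qed.

(** If v and w were in the cell and differed by a logical vector, each would be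
strictly shorter than the other. *)
Lemma voronoi_inj v w : voronoi v -> voronoi w -> dual_lattice L (v - w) ->
  v - w \in Lam.
Proof.
move=> vv vw d; apply: contrapT => /negP nL.
have l1 : logical L (v - w) by [].
have E1 : v - (v - w) = w by rewrite opprB addrC subrK.
have E2 : w - - (v - w) = v by rewrite opprK addrC subrK.
have := vv _ l1; have := vw _ (logicalN l1); rewrite E1 E2 => h1 h2.
by have := lt_trans h1 h2; rewrite ltxx.
Qed.

Section NearestDecoder.
Variable kappa : nat -> V.
Hypothesis kappa_dual : forall k, dual_lattice L (kappa k).
Hypothesis kappa_all : forall v, dual_lattice L v -> exists k, v = kappa k.

(* The first index leading into the cell; minimality makes the choice measurable. *)
Let hit (v : V) : set nat :=
  [set k | voronoi (v + kappa k) /\ forall j, (j < k)%N -> ~ voronoi (v + kappa j)].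

Let hit_measurable k : measurable [set v : borel_cover L | hit v k].
Proof.
have mk j : measurable [set v : borel_cover L | voronoi (v + kappa j)].
  rewrite -[X in measurable X]setTI.
  exact: (measurable_translation L_ample (kappa j) _ voronoi_measurable).
rewrite (_ : [set v | _] = [set v : borel_cover L | voronoi (v + kappa k)] `&`
    \bigcap_(j in [set j | (j < k)%N]) ~` [set v : borel_cover L | voronoi (v + kappa j)]).
  apply: measurableI => //; apply: bigcap_measurableType => j _; exact: measurableC.
by [].
Qed.

Let hit_inj v j k : hit v j -> hit v k -> j = k.
Proof.
move=> [vj hj] [vk hk]; have [jk|kj|//] := ltngtP j k.
  by case: (hk _ jk).
by case: (hj _ kj).
Qed.

Let hit_ex v k : voronoi (v + kappa k) -> exists j, hit v j.
Proof.
elim/ltn_ind: k => k IH vk.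
have [[j jk vj]|h] := pselect (exists2 j, (j < k)%N & voronoi (v + kappa j)).
  exact: IH jk vj.
by exists k; split => // j jk vj; apply: h; exists j.
Qed.

(** Moves v into the cell by a dual vector whenever this is possible. *)
Definition reduce (v : borel_cover L) : borel_cover L :=
  if pselect (exists k, hit v k) is left h then v + kappa (projT1 (cid h)) else v.

Lemma reduce_hit v k : hit v k -> reduce v = v + kappa k.
Proof.
move=> hk; rewrite /reduce; case: pselect => [h|]; last by case; exists k.
by case: cid => j hj /=; rewrite (hit_inj hj hk).
Qed.

Lemma reduce_nohit v : ~ (exists k, hit v k) -> reduce v = v.
Proof. by rewrite /reduce; case: pselect. Qed.

Lemma measurable_reduce : measurable_fun setT reduce.
Proof.
move=> _ Y mY; rewrite setTI.
rewrite (_ : reduce @^-1` Y =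
    (\bigcup_k ([set v : borel_cover L | hit v k] `&` [set v : borel_cover L | Y (v + kappa k)]))
    `|` ((~` \bigcup_k [set v : borel_cover L | hit v k]) `&` Y)).
  apply: measurableU.
    apply: bigcupT_measurable => k; apply: measurableI => //.
    rewrite -[X in measurable X]setTI.
    exact: (measurable_translation L_ample (kappa k) _ mY).
  by apply: measurableI => //; apply/measurableC/bigcupT_measurable.
apply/seteqP; split => v.
  rewrite /preimage/= => Yv; have [h|h] := pselect (exists k, hit v k).
    by have [k hk] := h; left; exists k => //; split => //; rewrite /= -(reduce_hit hk).
  by right; split; [move=> [k _ hk]; apply: h; exists k|rewrite -(reduce_nohit h)].
move=> [[k _ [hk Yk]]|[h Yv]]; rewrite /preimage/=; first by rewrite (reduce_hit hk).
by rewrite reduce_nohit// => -[k hk]; apply: h; exists k.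
Qed.

Lemma reduce_dual v : dual_lattice L (reduce v - v).
Proof.
have [[k hk]|h] := pselect (exists k, hit v k).
  by rewrite (reduce_hit hk) addrAC subrr add0r.
by rewrite reduce_nohit// subrr; apply: sub_dual_lattice; exact: rpred0.
Qed.

Lemma reduce_voronoi v w : voronoi w -> dual_lattice L (w - v) -> voronoi (reduce v).
Proof.
move=> vw /kappa_all[k kE].
have [j hj] : exists j, hit v j by apply: (@hit_ex v k); rewrite -kE subrKC.
by rewrite (reduce_hit hj); exact: hj.1.
Qed.

End NearestDecoder.

Lemma measurable_cover :
  measurable_fun setT (cover Lam : borel_cover L -> borel_torus L).
Proof.
apply: (@measurability _ _ _ (borel_torus L) _ _ (torus_opens L) erefl).
by move=> _ [U oU <-]; rewrite setTI; apply: sub_sigma_algebra.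
Qed.

(** Two points of the cell with the same image under the isogeny differ by a vector
of Lam, so the decoder that reduces a lift returns every point of the cell. *)
Lemma nearest_decoder : exists2 D : borel_Pic0 -> borel_torus L,
  decoder D & voronoi `<=` cover Lam @^-1` range D.
Proof.
have [kappa [kd kE]] := dual_lattice_enum L_ample Lam_lattice.
have [tau [mtau tauK]] := isogeny_section L_ample Lam_lattice.
pose D xi : borel_torus L := cover Lam (reduce kappa (tau xi)).
have DK xi : polarization_isogeny L (D xi) = xi.
  rewrite -[RHS]tauK; apply/isogeny_eqP; exact: reduce_dual.
exists D.
  split => //; apply: (measurableT_comp measurable_cover).
  exact: (measurableT_comp (measurable_reduce kappa) mtau).
move=> w vw; pose xi := polarization_isogeny L (cover Lam w).
exists xi => //; apply/cover_eq.
have d : dual_lattice L (w - tau xi) by apply/isogeny_eqP; rewrite tauK.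
apply: voronoi_inj => //; first exact: (reduce_voronoi kE vw d).
rewrite (_ : _ - w = (reduce kappa (tau xi) - tau xi) - (w - tau xi)).
  by apply: dual_latticeB => //; exact: reduce_dual.
by rewrite opprB subrKA.
Qed.

Section OneSigma.
Variable sigma : R.
Hypothesis sigma0 : 0 < sigma.
Variable r2 : R.
Hypothesis r2_gap : forall v, logical L v -> ip L v v < ell L ^+ 2 + 4 * r2 ->
  flat_norm L v = ell L.

Let sn0 : sigma != 0. Proof. by rewrite gt_eqF. Qed.
Let q := half_tail L sigma.
Let t := fine (gaussian sigma (far (L := L) r2)).

(** If |v - mu| <= |v| then |mu|^2 <= 4 |v|^2, so that mu is shortest as soon as v is
in the ball, by the gap r2 above the minimal length. *)
Lemma voronoi_compl : ~` voronoi `<=`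
  (\bigcup_(mu in shortest L)
     [set v : borel_cover L | ip L mu v \in `[(ell L ^+ 2 / 2), +oo[]) `|` far (L := L) r2.
Proof.
move=> v nv; have [f|nf] := leP (ell L ^+ 2 / 4 + r2) (ip L v v); first by right.
left; apply: contrapT => h; apply: nv => mu lmu; apply/voronoi_ipP.
rewrite ltNge; apply/negP => hmu.
have smu : shortest L mu.
  split => //; apply: r2_gap => //.
  have := ip_ge0 L_ample (v + v - mu); rewrite ip_subb !ipDl !ipDr (ipC L v mu).
  by move: nf hmu; lra.
apply: h; exists mu => //; rewrite /= in_itv/= andbT.
by rewrite -(ip_shortest L_ample smu).
Qed.

Lemma gaussian_voronoi :
  ((1 - ((nb_nearest L)%:R * q + t))%:E <= gaussian sigma voronoi)%E.
Proof.
have [P PE] := gaussian_probability L_ample sn0.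
have fS := shortest_finite L_ample Lam_lattice.
have mV := voronoi_measurable.
have mH mu : shortest L mu ->
  measurable [set v : borel_cover L | ip L mu v \in `[(ell L ^+ 2 / 2), +oo[].
  by move=> _; exact: measurable_halfspace.
have mF := far_measurable L_ample r2.
have mB := fin_bigcup_measurable fS mH.
rewrite -PE -[voronoi]setCK probability_setC; last exact: measurableC.
rewrite EFinB leeB// EFinD.
apply: (@le_trans _ _ (P ((\bigcup_(mu in shortest L)
     [set v : borel_cover L | ip L mu v \in `[(ell L ^+ 2 / 2), +oo[]) `|` far (L := L) r2))).
  apply: le_measure; rewrite ?inE.
  - exact: measurableC.
  - exact: measurableU.
  - exact: voronoi_compl.
apply: le_trans (measureU2 _ mB mF) _; apply: leeD.
  rewrite -sum_shortest//.
  apply: le_trans (content_sub_fsum _ fS mH mB (@subset_refl _ _)) _.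
  apply: lee_fsum => // mu smu.
  have h := gaussian_half L_ample Lam_lattice K_nontrivial sigma0 true smu.
  by rewrite -h -PE.
by rewrite -(gaussian_farE L_ample sigma0) -PE.
Qed.

Hypothesis r2_sep : forall v, dual_lattice L v -> ip L v v < 16 * r2 -> v = 0.

Lemma robustness_bounds :
  ((1 - ((nb_nearest L)%:R * q + t))%:E <= gaussian_robustness L sigma <=
   (1 - (nb_nearest L)%:R * (q - t))%:E)%E.
Proof.
apply/andP; split.
  have [D dD VD] := nearest_decoder.
  apply: le_trans gaussian_voronoi _.
  apply: (@le_trans _ _ (gaussian_noise sigma (range D))); last first.
    by apply: ereal_sup_ubound; exists D.
  rewrite /gaussian_noise /pushforward /gaussian.
  have [vol ->] := volume_measure L_ample.
  have g0 v : (0 <= (gaussian_density L sigma v)%:E)%E.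
    by rewrite lee_fin gaussian_density_ge0.
  rewrite !ge0_integralE//.
  apply: le_ereal_sup => _ [f /= fA <-]; exists f => // v.
  apply: le_trans (fA v) _; rewrite !patchE.
  case: ifPn => [vV|_]; last by case: ifP.
  by rewrite mem_set//; apply: VD; exact: set_mem.
apply: ge_ereal_sup => _ [D dD <-].
apply: gaussian_inner_regular => // S mS SD.
apply: gaussian_converse => // v mu lmu Sv Svmu.
have := decoder_range_inj dD (SD _ Sv) (SD _ Svmu).
rewrite opprB [v + _]addrC subrK => /(_ lmu.1).
by apply/negP; exact: lmu.2.
Qed.

End OneSigma.
End Achievability.

(** * Comparison with the leading term *)

Section Asymptotics.
Context {R : realType} {V : vectType R[i]} {Lam : zmodClosed V}.
Variable L : line_bundle Lam.
Hypothesis L_ample : ample L.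
Hypothesis Lam_lattice : is_lattice Lam.
Hypothesis K_nontrivial : exists2 x : torus Lam, Kgroup L x & x != 0.

(** The asymptotic contribution of one shortest vector: the first term of the
expansion of [half_tail]. *)
Definition leading_term (sigma : R) : R :=
  2 * sigma / (ell L * Num.sqrt (2 * pi)) *
  expR (- (ell L ^+ 2 / (8 * sigma ^+ 2))).

Let ell0 : 0 < ell L. Proof. exact: ell_gt0. Qed.

Lemma leading_term_gt0 sigma : 0 < sigma -> 0 < leading_term sigma.
Proof.
move=> s0; rewrite mulr_gt0 ?expR_gt0// divr_gt0 ?mulr_gt0// sqrtr_gt0.
by rewrite mulr_gt0// pi_gt0.
Qed.

Lemma half_tail_bounds sigma : 0 < sigma ->
  (1 - 4 * sigma ^+ 2 / ell L ^+ 2) * leading_term sigma <= half_tail L sigma <=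
  leading_term sigma.
Proof.
move=> s0; have l2 : 0 < ell L / 2 by rewrite divr_gt0.
have [] := normal_tail_bounds s0 l2.
have s2 : Num.sqrt (2 * pi) != 0 :> R by rewrite gt_eqF// sqrtr_gt0 mulr_gt0// pi_gt0.
have -> : sigma / (ell L / 2 * Num.sqrt (2 * pi)) * expR (- ((ell L / 2) ^+ 2 / (2 * sigma ^+ 2))) =
    leading_term sigma.
  rewrite /leading_term; congr (_ * expR (- _)).
    by field; rewrite s2 gt_eqF.
  by field; rewrite gt_eqF.
have p0 := leading_term_gt0 s0.
set I := (\int[_]_(x in _) _)%E => h1 h2.
have I0 : (0 <= I)%E by apply: integral_ge0 => x _; rewrite lee_fin normal_pdf_ge0.
have If : I \is a fin_num by rewrite ge0_fin_numE// (le_lt_trans h1)// ltry.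
move: h1 h2; rewrite /half_tail -/I -[in X in X -> _](fineK If) -[in X in _ -> X -> _](fineK If).
rewrite -EFinM !lee_fin => h1 h2; rewrite h1 andbT.
have xy : 4 * sigma ^+ 2 / ell L ^+ 2 = sigma ^+ 2 / (ell L / 2) ^+ 2.
  by field; rewrite gt_eqF.
move: h2; rewrite -xy; set z := 4 * _ / _ => h2.
have z0 : 0 <= z by rewrite /z divr_ge0 ?sqr_ge0// mulr_ge0// sqr_ge0.
have q0 : 0 <= fine I by rewrite fine_ge0.
nra.
Qed.

Variable r2 : R.
Hypothesis r20 : 0 < r2.

(** The squared radius exceeds [ell L ^+ 2 / 4] by r2, and the Chernoff bound loses
only half of this excess for a suitable A; what remains is a factor
exp(- r2 / (4 sigma^2)), at most 4 sigma^2 / r2. *)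
Lemma far_bound : exists2 K : R, 0 <= K & forall sigma, 0 < sigma ->
  fine (gaussian sigma (far (L := L) r2)) <= K * sigma * leading_term sigma.
Proof.
pose c2 := ell L ^+ 2 / 4 + r2.
have c20 : 0 < c2 by rewrite addr_gt0// divr_gt0// exprn_gt0.
(* This A gives c2 (1 - A^2) = c2 - r2 / 2. *)
pose A := Num.sqrt (r2 / (2 * c2)).
have A20 : 0 < r2 / (2 * c2) by rewrite divr_gt0// mulr_gt0.
have A2 : A ^+ 2 = r2 / (2 * c2) by rewrite sqr_sqrtr// ltW.
have A0 : 0 < A by rewrite sqrtr_gt0.
have A1 : A <= 1.
  rewrite -(@expr_le1 _ 2 A) ?(ltW A0)// A2 ler_pdivrMr ?mulr_gt0// mul1r /c2.
  by have := sqr_ge0 (ell L); have := r20; lra.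
have cA : c2 * (1 - A ^+ 2) = ell L ^+ 2 / 4 + r2 / 2.
  rewrite A2 mulrBr mulr1 (_ : c2 * (r2 / (2 * c2)) = r2 / 2); first by rewrite /c2; lra.
  by field; rewrite gt_eqF.
have s2 : 0 < Num.sqrt (2 * pi) :> R by rewrite sqrtr_gt0 mulr_gt0// pi_gt0.
pose C : R := A ^- (dim V + dim V).
have C0 : 0 <= C by rewrite invr_ge0 exprn_ge0// ltW.
exists (C * (2 * ell L * Num.sqrt (2 * pi) / r2)).
  by rewrite mulr_ge0// divr_ge0 ?mulr_ge0 ?ltW.
move=> sigma s0; have sn0 : sigma != 0 by rewrite gt_eqF.
have := gaussian_ball_compl L_ample c2 s0 A0 A1.
rewrite -[X in (X <= _)%E -> _]/(gaussian sigma (far (L := L) r2)).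
rewrite gaussian_farE// lee_fin => /le_trans; apply.
rewrite -/C cA -[leRHS]mulrA -[leRHS]mulrA; apply: ler_wpM2l => //.
rewrite (_ : (ell L ^+ 2 / 4 + r2 / 2) / (2 * sigma ^+ 2) =
  ell L ^+ 2 / (8 * sigma ^+ 2) + r2 / (4 * sigma ^+ 2)); last by field.
rewrite opprD expRD mulrC /leading_term.
set e := expR (- (ell L ^+ 2 / _)).
have e0 : 0 < e by exact: expR_gt0.
have y0 : 0 < r2 / (4 * sigma ^+ 2) by rewrite divr_gt0// mulr_gt0// exprn_gt0.
have hy : expR (- (r2 / (4 * sigma ^+ 2))) <= 4 * sigma ^+ 2 / r2.
  rewrite expRN -[leRHS]invrK lef_pV2 ?posrE ?expR_gt0 ?invr_gt0 ?divr_gt0 ?mulr_gt0 ?exprn_gt0//.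
  rewrite invf_div; apply: le_trans (expR_ge1Dx _); lra.
rewrite (_ : 2 * ell L * Num.sqrt (2 * pi) / r2 *
    (sigma * (2 * sigma / (ell L * Num.sqrt (2 * pi)) * e)) =
  4 * sigma ^+ 2 / r2 * e).
  by rewrite ler_wpM2r// ltW.
by field; rewrite !gt_eqF.
Qed.

Hypothesis r2_gap : forall v, logical L v -> ip L v v < ell L ^+ 2 + 4 * r2 ->
  flat_norm L v = ell L.
Hypothesis r2_sep : forall v, dual_lattice L v -> ip L v v < 16 * r2 -> v = 0.

Lemma relative_bounds : exists K : R, forall sigma, 0 < sigma ->
  1 - 4 * sigma ^+ 2 / ell L ^+ 2 - K * sigma <=
  fine (1 - gaussian_robustness L sigma)%E / ((nb_nearest L)%:R * leading_term sigma)
  <= 1 + K * sigma.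
Proof.
have [K K0 Kt] := far_bound; exists K => sigma s0.
have p0 := leading_term_gt0 s0.
have N1 : 1 <= (nb_nearest L)%:R :> R by rewrite ler1n nb_nearest_gt0.
have N0 : 0 < (nb_nearest L)%:R :> R by rewrite (lt_le_trans _ N1).
have := robustness_bounds L_ample Lam_lattice K_nontrivial s0 r2_gap r2_sep.
set rho := gaussian_robustness L sigma.
set t := fine (gaussian _ _); have tK : t <= K * sigma * leading_term sigma by exact: Kt.
move=> /andP[r1 r3].
have rf : rho \is a fin_num.
  rewrite fin_numE; apply/andP; split.
    by apply: contraTneq r1 => ->; rewrite leeNy_eq.
  by apply: contraTneq r3 => ->; rewrite leye_eq.
move: r1 r3; rewrite -(fineK rf) -EFinB !lee_fin [fine _]/= => r1 r3.
have /andP[q1 q2] := half_tail_bounds s0.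
set x := 4 * _ / _ in q1 *.
have Np0 : 0 < (nb_nearest L)%:R * leading_term sigma by rewrite mulr_gt0.
have NK : t <= (nb_nearest L)%:R * (K * sigma * leading_term sigma).
  apply: le_trans tK _; rewrite ler_peMl//.
  by apply: mulr_ge0; [apply: mulr_ge0 => //; exact: ltW|exact: ltW].
have Nq1 := ler_wpM2l (ltW N0) q1; have Nq2 := ler_wpM2l (ltW N0) q2.
have NtK := ler_wpM2l (ltW N0) tK.
rewrite -[fine (_)%:E]/(1 - fine rho).
move: (fine rho) r1 r3 => u r1 r3; move: x q1 Nq1 => x q1 Nq1.
apply/andP; split; first by rewrite ler_pdivlMr//; lra.
by rewrite ler_pdivrMr//; lra.
Qed.

End Asymptotics.

(** * The asymptotic formula *)

Theorem theorem1p6 (R : realType) (V : vectType R[i]) (Lam : zmodClosed V)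
    (L : line_bundle Lam) (Lam_lattice : is_lattice Lam) (L_ample : ample L)
    (K_nontrivial : exists2 x : torus Lam, Kgroup L x & x != 0) :
  (fun sigma : R =>
     fine (1 - gaussian_robustness L sigma)%E /
     (2 * (nb_nearest L)%:R * sigma / (ell L * Num.sqrt (2 * pi)) *
      expR (- (ell L ^+ 2 / (8 * sigma ^+ 2)))))
  @ 0^'+ --> (1 : R).
Proof.
have [delta d0 gap] := ell_gap L_ample Lam_lattice K_nontrivial.
have [m0 m00 sep] := dual_lattice_separated L_ample Lam_lattice.
(* In the ball of squared radius ell^2 / 4 + r2, only shortest logical vectors may
compete with 0, whence 4 r2 <= delta; the caps of this ball must be disjoint,
whence 16 r2 at most the squared minimal length m0 of Lam^#. *)
pose r2 := Num.min (delta / 4) (m0 / 16).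
have r20 : 0 < r2 by rewrite lt_min !divr_gt0.
have r2d : 4 * r2 <= delta by rewrite mulrC -ler_pdivlMr// ge_min lexx.
have r2m : 16 * r2 <= m0 by rewrite mulrC -ler_pdivlMr// ge_min lexx orbT.
have [||K KP] := relative_bounds L_ample Lam_lattice K_nontrivial r20.
- by move=> v lv h; apply: gap => //; apply: lt_le_trans h _; rewrite lerD2l.
- by move=> v dv h; apply: sep => //; exact: lt_le_trans h r2m.
have c0 : (fun sigma : R => sigma) @ 0^'+ --> (0 : R).
  by apply: cvg_at_right_filter; exact: cvg_id.
apply: (@squeeze_cvgr _ _ _ _
  (fun sigma => 1 - 4 * sigma ^+ 2 / ell L ^+ 2 - K * sigma)
  (fun sigma => 1 + K * sigma)).
- near=> sigma.
  have s0 : 0 < sigma by near: sigma; exact: nbhs_right_gt.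
  rewrite (_ : _ * expR _ = (nb_nearest L)%:R * leading_term L sigma).
    exact: KP.
  by rewrite /leading_term !mulrA [(nb_nearest L)%:R * 2]mulrC.
- have h : (1 - 4 * 0 ^+ 2 / ell L ^+ 2 - K * 0 : R) = 1 by rewrite expr0n /=; ring.
  rewrite -[X in _ --> X]h.
  apply: cvgB; last by apply: cvgM => //; exact: cvg_cst.
  apply: cvgB; first exact: cvg_cst.
  apply: cvgM; last exact: cvg_cst.
  apply: cvgM; first exact: cvg_cst.
  by apply: cvgM.
- have h : (1 + K * 0 : R) = 1 by ring.
  rewrite -[X in _ --> X]h.
  apply: cvgD; first exact: cvg_cst.
  by apply: cvgM => //; exact: cvg_cst.
Unshelve. all: end_near.
Qed.
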